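(* There is an absolute constant $K$ such that the following holds. Let $X$ be a finite regular cell complex of dimension $d\ge 1$ and $\mathcal F$ a weighted cellular cosheaf on $X$ with $\dim C_{d-1}(X;\mathcal F)=n\ge 2$. Given $\epsilon>0$, there exists a subcomplex $X'\subseteq X$ with the same $(d-1)$-skeleton as $X$ and with at most $K\epsilon^{-2}n\log n$ $d$-cells, together with a weighted cellular cosheaf $\mathcal F'$ on $X'$, with the same inner product stalks as $\mathcal F$ on $(d-1)$-cells (so that $C_{d-1}(X';\mathcal F')=C_{d-1}(X;\mathcal F)$), such that $$(1-\epsilon)L^{d-1}_{\mathcal F}\preceq L^{d-1}_{\mathcal F'}\preceq(1+\epsilon)L^{d-1}_{\mathcal F}.$$
   Context: A regular cell complex is identified with its face poset; $\sigma\trianglelefteq\tau$ means that the cell $\sigma$ is contained in the closure of $\tau$. The $k$-skeleton is the subcomplex of cells of dimension at most $k$. A weighted cellular cosheaf $\mathcal F$ on $X$ assigns to each cell $\sigma$ a finite-dimensional inner product space $\mathcal F(\sigma)$ over $\Bbbk=\mathbb R$ or $\mathbb C$ (its stalk) and to each $\sigma\trianglelefteq\tau$ a linear extension map $\mathcal F_{\sigma\trianglelefteq\tau}:\mathcal F(\tau)\to\mathcal F(\sigma)$ with $\mathcal F_{\sigma\trianglelefteq\sigma}=\mathrm{id}$ and $\mathcal F_{\rho\trianglelefteq\tau}=\mathcal F_{\rho\trianglelefteq\sigma}\circ\mathcal F_{\sigma\trianglelefteq\tau}$ for $\rho\trianglelefteq\sigma\trianglelefteq\tau$. The chain spaces are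 the orthogonal direct sums $C_k(X;\mathcal F)=\bigoplus_{\dim\sigma=k}\mathcal F(\sigma)$. Fix a signed incidence relation $[\sigma:\tau]\in\{0,\pm1\}$ coming from orientations of cells: it is nonzero exactly when $\sigma$ is a codimension-one face of $\tau$, and $\sum_\gamma[\sigma:\gamma][\gamma:\tau]=0$ for all $\sigma\trianglelefteq\tau$. The boundary map $\partial_{k+1}:C_{k+1}(X;\mathcal F)\to C_k(X;\mathcal F)$ is $(\partial_{k+1}c)_\sigma=\sum_{\dim\tau=k+1}[\sigma:\tau]\mathcal F_{\sigma\trianglelefteq\tau}(c_\tau)$. The degree-$k$ up-Laplacian is $L^k_{\mathcal F}=\partial_{k+1}\partial_{k+1}^*$. For self-adjoint operators, $A\preceq B$ means $B-A$ is positive semidefinite. *)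

(* Defs.v *)
From HB Require Import structures.
From mathcomp Require Import all_boot all_order all_algebra.
From mathcomp Require Import complex.
From mathcomp Require Import all_classical all_reals all_analysis.

Set Implicit Arguments.
Unset Strict Implicit.
Unset Printing Implicit Defensive.

Import Order.TTheory GRing.Theory Num.Theory.
Import numFieldNormedType.Exports.

Local Open Scope ring_scope.

Variant ground_field := RealNumbers | ComplexNumbers.

Definition scalar_field (R : realType) (k : ground_field) : numFieldType :=
  match k with RealNumbers => R | ComplexNumbers => R[i] end.

Definition scalar_conj (R : realType) (k : ground_field) :
    involutive_rmorphism (scalar_field R k) :=
  match k with RealNumbers => idfun | ComplexNumbers => Num.conj end.

Definition of_real (R : realType) (k : ground_field) : R -> scalar_field R k :=
  match k with RealNumbers => idfun | ComplexNumbers => real_complex R end.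
Arguments scalar_conj R k : clear implicits.
Arguments of_real {R} k.

(* The forms of type {dot _ for theta} are linear in the first argument and
   theta-linear in the second. *)
Record inner_space (K : numFieldType) (theta : K -> K) := InnerSpace {
  inner_sort :> vectType K;
  dotp : {dot inner_sort for theta}
}.
Arguments inner_space K theta : clear implicits.
Arguments dotp {K theta} _.

Section DirectSumVect.
Variables (K : numFieldType) (I : finType) (V : I -> vectType K).

Definition dsum_sort := {dffun forall i, V i}.

HB.instance Definition _ := Choice.on dsum_sort.

Implicit Types c : dsum_sort.

Definition dsum_zero : dsum_sort := [ffun i => 0 : V i].
Definition dsum_opp c : dsum_sort := [ffun i => - c i].
Definition dsum_add c c' : dsum_sort := [ffun i => c i + c' i].
Definition dsum_scale a c : dsum_sort := [ffun i => a *: c i].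

Fact dsum_addA : associative dsum_add.
Proof. by move=> x y z; apply/ffunP => i; rewrite !ffunE addrA. Qed.
Fact dsum_addC : commutative dsum_add.
Proof. by move=> x y; apply/ffunP => i; rewrite !ffunE addrC. Qed.
Fact dsum_add0 : left_id dsum_zero dsum_add.
Proof. by move=> x; apply/ffunP => i; rewrite !ffunE add0r. Qed.
Fact dsum_addN : left_inverse dsum_zero dsum_opp dsum_add.
Proof. by move=> x; apply/ffunP => i; rewrite !ffunE addNr. Qed.

HB.instance Definition _ := GRing.isZmodule.Build dsum_sort
  dsum_addA dsum_addC dsum_add0 dsum_addN.

Fact dsum_scaleA a b c : dsum_scale a (dsum_scale b c) = dsum_scale (a * b) c.
Proof. by apply/ffunP => i; rewrite !ffunE scalerA. Qed.
Fact dsum_scale1 : left_id 1 dsum_scale.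
Proof. by move=> x; apply/ffunP => i; rewrite !ffunE scale1r. Qed.
Fact dsum_scaleDr : right_distributive dsum_scale +%R.
Proof. by move=> a x y; apply/ffunP => i; rewrite !ffunE scalerDr. Qed.
Fact dsum_scaleDl c : {morph dsum_scale^~ c : a b / a + b}.
Proof. by move=> a b; apply/ffunP => i; rewrite !ffunE scalerDl. Qed.

HB.instance Definition _ := GRing.Zmodule_isLmodule.Build K dsum_sort
  dsum_scaleA dsum_scale1 dsum_scaleDr dsum_scaleDl.

Import VectorInternalTheory.

Fact dsum_vect_iso :
  Vector.axiom (\sum_(j < #|I|) dim (V (enum_val j))) dsum_sort.
Proof.
pose fr (c : dsum_sort) := \mxrow_(j < #|I|) v2r (c (enum_val j)).
exists fr.
  move=> a x y; apply/mxrowP => j.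
  have -> : submxrow (a *: fr x + fr y) j =
      a *: submxrow (fr x) j + submxrow (fr y) j by apply/rowP => k; rewrite !mxE.
  by rewrite !mxrowK !ffunE !semilinearP.
pose g (w : 'rV_(\sum_(j < #|I|) dim (V (enum_val j)))) : dsum_sort := [ffun i =>
  eq_rect _ (fun i => V i) (r2v (submxrow w (enum_rank i))) _ (enum_rankK i)].
have castE (c : dsum_sort) i i' (e : i' = i) :
    eq_rect _ (fun i => V i : Type) (c i') _ e = c i by case: _ / e.
exists g => [c|w].
  apply/ffunP => i; rewrite ffunE mxrowK v2rK.
  exact: castE.
apply/mxrowP => j; rewrite mxrowK ffunE.
have castI j' (e : enum_val j' = enum_val j) :
    eq_rect _ (fun i => V i : Type) (r2v (submxrow w j')) _ e = r2v (submxrow w j).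
  by have /enum_val_inj jj' := e; subst j'; rewrite (eq_axiomK e).
by rewrite castI r2vK.
Qed.

HB.instance Definition _ := Lmodule_hasFinDim.Build K dsum_sort dsum_vect_iso.

End DirectSumVect.

Section InnerProduct.
Variables (K : numFieldType) (theta : involutive_rmorphism K).

Lemma dotp_gt0 (V : inner_space K theta) (v : V) : v != 0 -> 0 < dotp V v v.
Proof. exact: neq0_dnorm_gt0. Qed.

Section DirectSum.
Variables (I : finType) (V : I -> inner_space K theta).

Local Notation dsumV := (dsum_sort (fun i => V i)).

Definition dsum_form (c c' : dsumV) : K := \sum_i dotp (V i) (c i) (c' i).

Fact dsum_form_bilinear :
  bilinear_for
    (GRing.Scale.Law.clone _ _ *%R _) (GRing.Scale.Law.clone _ _ (theta \; *%R) _)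
    dsum_form.
Proof.
split=> [c' a x y|c a x y]; rewrite /dsum_form /= mulr_sumr -big_split /=;
  apply: eq_bigr => i _; rewrite !ffunE ?linearPl ?linearPr //.
Qed.

HB.instance Definition _ := bilinear_isBilinear.Build K dsumV dsumV K
  _ _ dsum_form dsum_form_bilinear.

Fact dsum_form_hermitian (x y : dsumV) :
  dsum_form x y = (-1) ^+ false * theta (dsum_form y x).
Proof.
rewrite mul1r rmorph_sum; apply: eq_bigr => i _.
by rewrite hermC mul1r.
Qed.

HB.instance Definition _ :=
  isHermitianSesquilinear.Build K dsumV false theta dsum_form dsum_form_hermitian.

Fact dsum_form_gt0 (x : dsumV) : x != 0 -> 0 < dsum_form x x.
Proof.
move=> x_neq0.
have pos i : x i != 0 -> 0 < dotp (V i) (x i) (x i) by exact: dotp_gt0.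
have nneg i : 0 <= dotp (V i) (x i) (x i).
  by have [->|/pos/ltW//] := eqVneq (x i) 0; rewrite linear0l.
have [i xi] : exists i, x i != 0.
  apply/existsP; apply: contraNT x_neq0 => /existsPn x0.
  by apply/eqP/ffunP => i; rewrite ffunE; apply/eqP; rewrite -[_ == _]negbK x0.
by rewrite /dsum_form (bigD1 i) //= ltr_pwDl ?pos // sumr_ge0.
Qed.

HB.instance Definition _ := isDotProduct.Build K dsumV dsum_form dsum_form_gt0.

Definition dsum : inner_space K theta :=
  InnerSpace (Dot.clone _ _ theta dsum_form _).

End DirectSum.

Lemma dotpZl (V : inner_space K theta) a (u v : V) :
  dotp V (a *: u) v = a * dotp V u v.
Proof. exact: (@linearl_subproof _ _ _ _ _ _ (dotp V)). Qed.

Lemma dotpZr (V : inner_space K theta) a (u v : V) :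
  dotp V u (a *: v) = theta a * dotp V u v.
Proof. exact: (@linearr_subproof _ _ _ _ _ _ (dotp V)). Qed.

Section Adjoint.
Variables U V : inner_space K theta.

Lemma adjoint_exists (f : 'Hom(U, V)) :
  exists g : 'Hom(V, U), forall u v, dotp V (f u) v = dotp U u (g v).
Proof.
pose e := vbasis {:U}.
have eK u : u = \sum_i coord e i u *: e`_i by exact/coord_vbasis/memvf.
pose hfun (w : U) := \row_(i < \dim {:U}) dotp U w e`_i.
have hlin : linear hfun by move=> a x y; apply/rowP => i; rewrite !mxE linearPl.
pose hL := GRing.isLinear.Build _ _ _ _ hfun hlin.
pose hl : {linear U -> 'rV[K]_(\dim {:U})} := HB.pack hfun hL.
pose h := linfun hl.
have h_ker : lker h == 0%VS.
  rewrite -subv0; apply/subvP => w; rewrite memv_ker memv0 lfunE /= => /eqP hw0.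
  apply: contraT => /dotp_gt0 w_gt0.
  suff: dotp U w w == 0 by rewrite gt_eqF.
  rewrite {2}(eK w) linear_sumr big1 // => i _ /=.
  rewrite dotpZr.
  by have /rowP/(_ i) := hw0; rewrite !mxE => ->; rewrite mulr0.
have h_img : limg h = fullv.
  apply/eqP; rewrite eqEdim subvf /= [X in (X <= _)%N]dimvf /dim /= mul1n.
  have := limg_ker_dim h fullv; move/eqP: h_ker => ->.
  by rewrite capv0 dimv0 add0n => ->.
pose bfun (v : V) := \row_(i < \dim {:U}) dotp V v (f e`_i).
have blin : linear bfun by move=> a x y; apply/rowP => i; rewrite !mxE linearPl.
pose bL := GRing.isLinear.Build _ _ _ _ bfun blin.
pose bl : {linear V -> 'rV[K]_(\dim {:U})} := HB.pack bfun bL.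
exists (h^-1 \o linfun bl)%VF => u v; rewrite comp_lfunE.
set w := (h^-1)%VF _.
have hw : h w = bfun v by rewrite limg_lfunVK ?h_img ?memvf // lfunE.
have wE (i : 'I_(\dim {:U})) : dotp U w e`_i = dotp V v (f e`_i).
  by move: hw; rewrite lfunE /= => /rowP/(_ i); rewrite !mxE.
rewrite (hermC (dotp V)) (hermC (dotp U)) (eK u) linear_sum !linear_sumr.
congr (_ * theta _); apply: eq_bigr => i _.
by rewrite !linearZ /= wE.
Qed.

Definition adjoint (f : 'Hom(U, V)) : 'Hom(V, U) := sval (cid (adjoint_exists f)).

Lemma adjointP (f : 'Hom(U, V)) u v :
  dotp V (f u) v = dotp U u (adjoint f v).
Proof. exact: (svalP (cid (adjoint_exists f))). Qed.

Lemma adjoint_unique (f : 'Hom(U, V)) (g : 'Hom(V, U)) :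
  (forall u v, dotp V (f u) v = dotp U u (g v)) -> g = adjoint f.
Proof.
move=> gP; apply/lfunP => v; apply/eqP; rewrite -subr_eq0.
apply: contraT => /dotp_gt0.
have dot0 w : dotp U w (g v - adjoint f v) = 0.
  by rewrite linearB /= -gP -adjointP subrr.
by rewrite dot0 ltxx.
Qed.

End Adjoint.

Definition psd (V : inner_space K theta) (A : 'End(V)) :=
  adjoint A = A /\ forall v, 0 <= dotp V (A v) v.

Definition loewner_le (V : inner_space K theta) (A B : 'End(V)) := psd (B - A).

End InnerProduct.

Record face_poset := FacePoset {
  cell : finType;
  cell_dim : cell -> nat;
  face : rel cell;
  face_refl : reflexive face;
  face_anti : antisymmetric face;
  face_trans : transitive face;
  face_dim : forall s t, face s t -> s != t -> (cell_dim s < cell_dim t)%N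
}.
Arguments cell_dim {f} s.
Arguments face {f} s t.

Section RegularCellComplex.
Local Open Scope classical_set_scope.

Definition closed_unit_ball (R : realType) n : set 'rV[R]_n :=
  [set x | \sum_i x ord0 i ^+ 2 <= 1].
Definition open_unit_ball (R : realType) n : set 'rV[R]_n :=
  [set x | \sum_i x ord0 i ^+ 2 < 1].

(* A finite regular CW complex. The characteristic maps are automatically
   homeomorphisms onto the closed cells, being continuous injections of a
   compact space into a Hausdorff space. *)
Record regular_cell_complex (R : realType) := RegularCellComplex {
  space : topologicalType;
  space_hausdorff : hausdorff_space space;
  cw_cell : finType;
  cw_dim : cw_cell -> nat;
  open_cell : cw_cell -> set space;
  open_cell_cover : \bigcup_s open_cell s = setT;
  open_cell_disjoint : forall s t, s != t -> open_cell s `&` open_cell t = set0;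
  char_map : forall s, exists chi : 'rV[R]_(cw_dim s) -> space,
    [/\ {within @closed_unit_ball R (cw_dim s), continuous chi},
        set_inj (@closed_unit_ball R (cw_dim s)) chi,
        chi @` @closed_unit_ball R (cw_dim s) = closure (open_cell s) &
        chi @` @open_unit_ball R (cw_dim s) = open_cell s];
  cell_boundary : forall s x, closure (open_cell s) x -> ~ open_cell s x ->
    exists2 t, (cw_dim t < cw_dim s)%N & open_cell t x
}.

Variables (R : realType) (X : regular_cell_complex R).
Implicit Types s t u : cw_cell X.

Definition cw_face s t : bool := `[< open_cell s `<=` closure (open_cell t) >].

Lemma open_cell_neq0 s : open_cell s !=set0.
Proof.
have [chi [_ _ _ <-]] := char_map s.
exists (chi 0); exists 0 => //; rewrite /open_unit_ball /=.
by rewrite big1 ?ltr01 // => i _; rewrite mxE expr0n.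
Qed.

Lemma open_cell_inj s t x : open_cell s x -> open_cell t x -> s = t.
Proof.
move=> sx tx; apply/eqP/negPn/negP => /open_cell_disjoint/seteqP[/(_ x) + _].
exact.
Qed.

Lemma cw_face_refl : reflexive cw_face.
Proof. by move=> s; apply/asboolP/subset_closure. Qed.

Lemma cw_face_trans : transitive cw_face.
Proof.
move=> t s u /asboolP st /asboolP tu; apply/asboolP.
apply: (subset_trans st).
rewrite (_ : closure (open_cell u) = closure (closure (open_cell u))).
  exact: closureS.
by apply/closure_id; exact: closed_closure.
Qed.

Lemma cw_face_dim s t : cw_face s t -> s != t -> (cw_dim s < cw_dim t)%N.
Proof.
move=> /asboolP st neq_st; have [x sx] := open_cell_neq0 s.
have /(cell_boundary (st _ sx)) [u ltut ux] : ~ open_cell t x.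
  by move=> /(open_cell_inj sx)/eqP; rewrite (negPf neq_st).
by rewrite (open_cell_inj sx ux).
Qed.

Lemma cw_face_anti : antisymmetric cw_face.
Proof.
move=> s t /andP[st ts]; apply/eqP; apply: contraT => neq_st.
have := cw_face_dim st neq_st; rewrite eq_sym in neq_st.
by rewrite ltnNge ltnW // cw_face_dim.
Qed.

Definition cw_face_poset : face_poset :=
  FacePoset cw_face_refl cw_face_anti cw_face_trans cw_face_dim.

End RegularCellComplex.

Coercion cw_face_poset : regular_cell_complex >-> face_poset.

Definition dimension (P : face_poset) : nat := \max_(s : cell P) cell_dim s.

Definition skeleton (P : face_poset) (k : nat) : {set cell P} :=
  [set s | (cell_dim s <= k)%N].

Definition cells (P : face_poset) (k : nat) : {set cell P} :=
  [set s | cell_dim s == k].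

Section Subcomplex.
Variables (P : face_poset) (S : {set cell P}).

Definition is_subcomplex : Prop :=
  forall s t : cell P, face s t -> t \in S -> s \in S.

Definition sub_cell : finType := {s : cell P | s \in S}.
Definition sub_cell_dim (s : sub_cell) : nat := cell_dim (val s).
Definition sub_face : rel sub_cell := fun s t => face (val s) (val t).

Fact sub_face_refl : reflexive sub_face.
Proof. by move=> s; apply: face_refl. Qed.
Fact sub_face_anti : antisymmetric sub_face.
Proof. by move=> s t /face_anti /val_inj. Qed.
Fact sub_face_trans : transitive sub_face.
Proof. by move=> t s u; apply: face_trans. Qed.
Fact sub_face_dim s t :
  sub_face s t -> s != t -> (sub_cell_dim s < sub_cell_dim t)%N.
Proof. exact: face_dim. Qed.

(* The induced poset on any set of cells; it is the face poset of a subcomplex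
   when [is_subcomplex] holds. *)
Definition subcomplex : face_poset :=
  FacePoset sub_face_refl sub_face_anti sub_face_trans sub_face_dim.

End Subcomplex.

Definition incidence (P : face_poset) := cell P -> cell P -> int.

Definition signed_incidence (P : face_poset) (inc : incidence P) : Prop :=
  [/\ forall s t, inc s t \in [:: 0; 1; -1],
      forall s t, inc s t != 0 <-> face s t /\ cell_dim t = (cell_dim s).+1 &
      forall s t, face s t -> \sum_u inc s u * inc u t = 0].

Definition sub_incidence (P : face_poset) (S : {set cell P})
    (inc : incidence P) : incidence (subcomplex S) :=
  fun s t => inc (val s) (val t).

(* [ext s t] is only meaningful when [face s t]. *)
Record cosheaf (K : numFieldType) (theta : K -> K) (P : face_poset) := Cosheaf {
  stalk : cell P -> inner_space K theta;
  ext : forall s t, 'Hom(stalk t, stalk s);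
  ext_id : forall s, ext s s = \1%VF;
  ext_comp : forall r s t, face r s -> face s t ->
    ext r t = (ext r s \o ext s t)%VF
}.
Arguments cosheaf K theta P : clear implicits.
Arguments ext {K theta P} c s t.

Section Chains.
Variables (K : numFieldType) (theta : involutive_rmorphism K).

Definition kcell (P : face_poset) k : finType := {s : cell P | cell_dim s == k}.

Section Laplacian.
Variables (P : face_poset) (F : cosheaf K theta P) (inc : incidence P).

Definition chain k : inner_space K theta :=
  dsum (fun s : kcell P k => stalk F (val s)).

Definition boundary_fun k (c : chain k.+1) : chain k :=
  [ffun s : kcell P k => \sum_(t : kcell P k.+1)
     (inc (val s) (val t))%:~R *: ext F (val s) (val t) (c t)].

Fact boundary_fun_linear k : linear (@boundary_fun k).
Proof.
move=> a x y; apply/ffunP => s; rewrite !ffunE scaler_sumr -big_split /=.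
apply: eq_bigr => t _.
by rewrite !ffunE linearP scalerDr !scalerA mulrC.
Qed.

HB.instance Definition _ k := GRing.isLinear.Build K (chain k.+1) (chain k)
  *:%R (@boundary_fun k) (@boundary_fun_linear k).

Definition boundary k : 'Hom(chain k.+1, chain k) := linfun (@boundary_fun k).

Definition up_laplacian k : 'End(chain k) :=
  (boundary k \o adjoint (boundary k))%VF.

End Laplacian.

Definition inner_cast (U V : inner_space K theta) (e : U = V) (u : U) : V :=
  eq_rect U (fun W : inner_space K theta => W : Type) u V e.

Fact inner_cast_linear (U V : inner_space K theta) (e : U = V) :
  linear (inner_cast e).
Proof. by case: V / e. Qed.

Fact inner_cast_isometry (U V : inner_space K theta) (e : U = V) u u' :
  dotp V (inner_cast e u) (inner_cast e u') = dotp U u u'.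
Proof. by case: V / e. Qed.

Section Transport.
Variables (P : face_poset) (S : {set cell P}) (k : nat).
Variables (F : cosheaf K theta P) (F' : cosheaf K theta (subcomplex S)).

Definition same_stalks : Prop :=
  forall s : cell (subcomplex S), cell_dim s = k -> stalk F' s = stalk F (val s).

Variable E : same_stalks.

Definition kcell_incl (s : kcell (subcomplex S) k) : kcell P k :=
  exist _ (val (val s)) (valP s).

(* The identification of C_k(X;F) with C_k(X';F') along the equalities of
   stalks; unitary when X' contains all k-cells of X (see
   [chain_transport_isometry] and [chain_transport_bij]). *)
Definition chain_transport_fun (c : chain F k) : chain F' k :=
  [ffun s : kcell (subcomplex S) k =>
     inner_cast (esym (E (eqP (valP s)))) (c (kcell_incl s))].

Fact chain_transport_fun_linear : linear chain_transport_fun.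
Proof.
move=> a x y; apply/ffunP => s; rewrite !ffunE.
exact: inner_cast_linear.
Qed.

HB.instance Definition _ := GRing.isLinear.Build K (chain F k) (chain F' k)
  *:%R chain_transport_fun chain_transport_fun_linear.

Definition chain_transport : 'Hom(chain F k, chain F' k) :=
  linfun chain_transport_fun.

Definition transport_end (A : 'End(chain F' k)) : 'End(chain F k) :=
  (chain_transport^-1 \o A \o chain_transport)%VF.

Lemma kcell_incl_bij : cells P k \subset S -> bijective kcell_incl.
Proof.
move=> /fintype.subsetP kS.
have inS (s : kcell P k) : val s \in S by rewrite kS // inE (valP s).
exists (fun s => exist _ (exist _ (val s) (inS s) : cell (subcomplex S)) (valP s)).
  by move=> s; do 2!apply: val_inj.
by move=> s; apply: val_inj.
Qed.

Lemma chain_transport_isometry : cells P k \subset S ->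
  forall x y, dotp (chain F' k) (chain_transport x) (chain_transport y)
            = dotp (chain F k) x y.
Proof.
move=> kS x y; rewrite /chain_transport !lfunE /= /dsum_form.
rewrite [RHS](reindex kcell_incl) /=; last exact/onW_bij/kcell_incl_bij.
by apply: eq_bigr => s _; rewrite !ffunE inner_cast_isometry.
Qed.

Lemma chain_transport_bij : cells P k \subset S -> bijective chain_transport.
Proof.
move=> kS; have [g gK Kg] := kcell_incl_bij kS.
pose z (y : chain F' k) s' : stalk F (val (kcell_incl s')) :=
  inner_cast (E (eqP (valP s'))) (y s').
pose x y : chain F k := [ffun s : kcell P k =>
  eq_rect _ (fun s => stalk F (val s) : Type) (z y (g s)) s (Kg s)].
have xE y s' : x y (kcell_incl s') = z y s'.
  rewrite ffunE; move: (Kg _); move: (g _) => t e.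
  have tE : t = s' by apply: (can_inj gK).
  by subst t; rewrite (eq_axiomK e).
have xK : cancel x chain_transport.
  move=> y; apply/ffunP => s'; rewrite lfunE ffunE xE.
  by rewrite /z; case: _ / (E _) (y s').
exists x => // c; apply/eqP; rewrite -subr_eq0.
apply: contraT => /dotp_gt0.
by rewrite -chain_transport_isometry // linearB /= xK subrr linear0l ltxx.
Qed.

End Transport.
End Chains.

(* Main.v *)
(* By the adjoint relation, <L v, v> is the sum over the d-cells t of the
   positive semidefinite forms q_t(v) = |(d^* v)_t|^2, and multiplying the
   extension maps out of t by sqrt(w_t) multiplies q_t by w_t. So it suffices
   to find nonnegative weights w, few of them nonzero, such that sum_t w_t q_t
   is within 1 +- eps of sum_t q_t; the cells of weight zero are then deleted.
   Over C the forms are restricted to real coordinates, which doubles the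
   dimension.

   The weights are produced by the deterministic barrier method of Batson,
   Spielman and Srivastava, in the version for matrices of arbitrary rank. With
   L = sum_t B_t positive definite, one adds multiples of the B_t to A one at a
   time, keeping l L < A < u L and keeping tr (L (u L - A)^-1) and
   tr (L (A - l L)^-1) below a constant e; in each step u and l increase by
   (1 - 4 e)^-1 and 1, and averaging over t yields an admissible update. After
   about n / e^2 steps u / l is close to 1. *)

From HB Require Import structures.
Require Import Defs.
From mathcomp Require Import all_boot all_order all_algebra.
From mathcomp Require Import all_classical all_reals all_analysis.
From mathcomp Require Import complex ring lra.

Set Implicit Arguments.
Unset Strict Implicit.
Unset Printing Implicit Defensive.

Import Order.TTheory GRing.Theory Num.Theory.

Local Open Scope ring_scope.

(** * Positive semidefinite real matrices and their resolvents *)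

Section PositiveMatrices.
Variables (R : realFieldType) (n : nat).
Implicit Types (A B L M P : 'M[R]_n) (x y z w : 'cV[R]_n).

Definition bil B x y : R := (x^T *m B *m y) 0 0.

Definition psdmx B := B^T = B /\ forall x, 0 <= bil B x x.
Definition pdmx B := B^T = B /\ forall x, x != 0 -> 0 < bil B x x.

Lemma bilDl B x y z : bil B (x + y) z = bil B x z + bil B y z.
Proof. by rewrite /bil linearD /= !mulmxDl mxE. Qed.
Lemma bilDr B x y z : bil B x (y + z) = bil B x y + bil B x z.
Proof. by rewrite /bil mulmxDr mxE. Qed.
Lemma bilZl B a x y : bil B (a *: x) y = a * bil B x y.
Proof. by rewrite /bil linearZ /= -!scalemxAl mxE. Qed.
Lemma bilZr B a x y : bil B x (a *: y) = a * bil B x y.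
Proof. by rewrite /bil -scalemxAr mxE. Qed.
Lemma bilD A B x y : bil (A + B) x y = bil A x y + bil B x y.
Proof. by rewrite /bil mulmxDr mulmxDl mxE. Qed.
Lemma bilN B x y : bil (- B) x y = - bil B x y.
Proof. by rewrite /bil mulmxN mulNmx mxE. Qed.
Lemma bilZ a B x y : bil (a *: B) x y = a * bil B x y.
Proof. by rewrite /bil -scalemxAr -scalemxAl mxE. Qed.
Lemma bil0 x y : bil 0 x y = 0.
Proof. by rewrite /bil mulmx0 mul0mx mxE. Qed.
Lemma bil_sum (I : finType) (B : I -> 'M[R]_n) x y :
  bil (\sum_i B i) x y = \sum_i bil (B i) x y.
Proof. by rewrite /bil mulmx_sumr mulmx_suml summxE. Qed.
Lemma bil_tr B x y : bil B x y = bil B^T y x.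
Proof.
by rewrite /bil -[in LHS](trmxK (_ *m y)) mxE !trmx_mul trmxK mulmxA.
Qed.
Lemma bilC B x y : B^T = B -> bil B x y = bil B y x.
Proof. by move=> Bs; rewrite bil_tr Bs. Qed.
Lemma bil_congr B P x y : bil (P^T *m B *m P) x y = bil B (P *m x) (P *m y).
Proof. by rewrite /bil trmx_mul !mulmxA. Qed.
Lemma bil_mxtrace B x y : bil B x y = \tr (y *m x^T *m B).
Proof. by rewrite -mulmxA mxtrace_mulC /mxtrace big_ord1. Qed.

Lemma pdmx_psd B : pdmx B -> psdmx B.
Proof.
move=> [Bs Bp]; split=> // x; have [->|/Bp/ltW//] := eqVneq x 0.
by rewrite /bil mulmx0 mxE.
Qed.

Lemma psdmx0 : psdmx 0.
Proof. by split; rewrite ?trmx0 // => x; rewrite bil0. Qed.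

Lemma psdmxD A B : psdmx A -> psdmx B -> psdmx (A + B).
Proof.
move=> [As Ap] [Bs Bp]; split; first by rewrite linearD /= As Bs.
by move=> x; rewrite bilD addr_ge0.
Qed.

Lemma psdmx_sum (I : finType) (B : I -> 'M[R]_n) :
  (forall i, psdmx (B i)) -> psdmx (\sum_i B i).
Proof. by move=> Bp; elim/big_ind: _ => //; [exact: psdmx0|exact: psdmxD]. Qed.

Lemma psdmx_congr B P : psdmx B -> psdmx (P^T *m B *m P).
Proof.
move=> [Bs Bp]; split; first by rewrite !trmx_mul Bs trmxK mulmxA.
by move=> x; rewrite bil_congr.
Qed.

(** Discriminant argument for the nonnegative form [q]: the point [(r, - s)] gives the bound up to
    the positive factor [r]. If [r] vanishes, [q] is affine in [b] at [a = 1], hence negative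
    somewhere unless [s] is zero. *)
Lemma psdmx_CS B x y : psdmx B -> bil B x y ^+ 2 <= bil B x x * bil B y y.
Proof.
move=> [Bs Bp]; have := Bp x; have := Bp y.
have q a b : 0 <= a ^+ 2 * bil B x x + 2 * a * b * bil B x y + b ^+ 2 * bil B y y.
  have := Bp (a *: x + b *: y).
  rewrite !(bilDl, bilDr, bilZl, bilZr) (bilC y x Bs).
  by congr (0 <= _); ring.
move: (bil B x x) (bil B y y) (bil B x y) q => p r s q r0 p0.
have [r_eq0|r_neq0] := eqVneq r 0; last first.
  have rp : 0 < r by rewrite lt_neqAle eq_sym r_neq0.
  rewrite -subr_ge0 -(pmulr_rge0 _ rp).
  by have := q r (- s); congr (0 <= _); ring.
have [->|s0] := eqVneq s 0; first by rewrite r_eq0 expr0n mulr0.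
have := q 1 (- (p + 1) / (2 * s)); rewrite r_eq0.
have -> : 1 ^+ 2 * p + 2 * 1 * (- (p + 1) / (2 * s)) * s +
   (- (p + 1) / (2 * s)) ^+ 2 * 0 = -1 by field.
by rewrite ler0N1.
Qed.

Lemma psdmx_ker B x : psdmx B -> bil B x x = 0 -> B *m x = 0.
Proof.
move=> Bp Bx; apply/colP => i; rewrite [RHS]mxE.
have := psdmx_CS (delta_mx i 0) x Bp.
rewrite Bx mulr0 /bil trmx_delta -rowE -row_mul mxE => h.
by apply/eqP; rewrite -sqrf_eq0 eq_le h sqr_ge0.
Qed.

Lemma pdmx1 : pdmx (1%:M : 'M[R]_n).
Proof.
split=> [|x x0]; first by rewrite trmx1.
have sq i : true -> 0 <= x^T 0 i * x i 0 by rewrite mxE -expr2 sqr_ge0.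
rewrite /bil mulmx1 mxE lt_neqAle sumr_ge0// andbT.
apply: contraNneq x0 => /esym/(psumr_eq0P sq) h; apply/eqP/colP => i.
by have := h i isT; rewrite [x^T _ _]mxE => /eqP; rewrite mulf_eq0 orbb mxE => /eqP.
Qed.

(** By Cauchy-Schwarz a nonzero entry at [(i, j)] forces a nonzero diagonal entry at [i], so a basis
    vector is a witness. *)
Lemma psdmx_neq0 B : psdmx B -> B != 0 -> exists x, 0 < bil B x x.
Proof.
move=> Bp B0; have [i|] := pickP (fun k : 'I_n * 'I_n => B k.1 k.2 != 0); last first.
  move=> B00; case/eqP: B0; apply/matrixP => i j; rewrite mxE.
  by have := B00 (i, j) => /negbFE/eqP.
case: i => i j /= Bij.
have := psdmx_CS (delta_mx i 0) (delta_mx j 0) Bp.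
rewrite {1}/bil trmx_delta -rowE -colE !mxE => h.
exists (delta_mx i 0); rewrite lt_neqAle (proj2 Bp) andbT.
apply: contraNneq Bij => e; move: h; rewrite -e mul0r => h.
by rewrite -sqrf_eq0 eq_le h sqr_ge0.
Qed.

(* Induction on the rank of [B], removing from [B] the rank-one part
   [B x x^T B / (x^T B x)], which keeps it positive semidefinite by
   Cauchy-Schwarz. *)
Lemma mxtrace_psd_ge0 P B : psdmx P -> psdmx B -> 0 <= \tr (P *m B).
Proof.
move=> Pp; have [r] := ubnP (\rank B); elim: r B => // r IH B rB Bp.
have [->|B0] := eqVneq B 0; first by rewrite mulmx0 mxtrace0.
have [x xp] := psdmx_neq0 Bp B0; have Bs := proj1 Bp.
set g := B *m x; set a := bil B x x in xp.
pose Q := 1%:M - a^-1 *: (g *m x^T).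
have gT : g^T = x^T *m B by rewrite /g trmx_mul Bs.
have B1E : Q *m B = B - a^-1 *: (g *m g^T).
  by rewrite mulmxBl mul1mx -scalemxAl gT mulmxA.
have bilg y z : bil (g *m g^T) y z = bil B x y * bil B x z.
  rewrite (bilC x y Bs) /bil -gT -(mulmxA y^T B) -/g.
  have -> : y^T *m (g *m g^T) *m z = (y^T *m g) *m (g^T *m z) by rewrite !mulmxA.
  by rewrite mxE big_ord1.
have B1p : psdmx (Q *m B).
  rewrite B1E; split=> [|y].
    by rewrite linearB linearZ /= trmx_mul trmxK Bs.
  rewrite bilD bilN bilZ bilg -(pmulr_rge0 _ xp) mulrBr mulVKf ?gt_eqF//.
  by rewrite subr_ge0 -expr2 psdmx_CS.
have B1x : Q *m B *m x = 0.
  rewrite B1E mulmxBl -scalemxAl -mulmxA (mx11_scalar (g^T *m x)) gT.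
  by rewrite mul_mx_scalar scalerA mulVf ?gt_eqF// scale1r subrr.
have rB1 : (\rank (Q *m B) < r)%N.
  rewrite -ltnS (leq_trans _ rB)// ltnS (ltn_leqif (mxrank_leqif_sup (submxMl Q B))).
  apply/negP => /submxP[D BD].
  by move: xp; rewrite /a /bil -mulmxA BD -mulmxA B1x !mulmx0 mxE ltxx.
have -> : P *m B = P *m (Q *m B) + a^-1 *: (P *m (g *m g^T)).
  by rewrite B1E mulmxBr -scalemxAr subrK.
rewrite mxtraceD addr_ge0 ?IH// mxtraceZ mulr_ge0 ?invr_ge0 ?(ltW xp)//.
by rewrite mxtrace_mulC -bil_mxtrace (proj2 Pp).
Qed.

Lemma pdmx_unit M : pdmx M -> M \in unitmx.
Proof.
move=> [Ms Mp]; rewrite -row_free_unit -kermx_eq0; apply: contraT.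
case/rowV0Pn => v /sub_kermxP vM v0.
have : 0 < bil M v^T v^T by apply: Mp; rewrite trmx_eq0.
by rewrite /bil trmxK vM mul0mx mxE ltxx.
Qed.

Lemma bil_inv M x y : M \in unitmx -> M^T = M ->
  bil (invmx M) x y = bil M (invmx M *m x) (invmx M *m y).
Proof.
by move=> Mu Ms; rewrite -bil_congr trmx_inv Ms mulVmx// mul1mx.
Qed.

Lemma bil_mulKV M x y : M \in unitmx -> bil M x (invmx M *m y) = (x^T *m y) 0 0.
Proof. by move=> Mu; rewrite /bil -mulmxA mulKVmx. Qed.

Lemma pdmx_inv M : pdmx M -> pdmx (invmx M).
Proof.
move=> Mp; have Mu := pdmx_unit Mp; have [Ms Mx] := Mp.
split; first by rewrite trmx_inv Ms.
move=> x x0; rewrite bil_inv// Mx//; apply: contraNneq x0 => x0.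
by rewrite -[x](mulKVmx Mu) x0 mulmx0.
Qed.

Lemma psdmx_sandwich M B : pdmx M -> psdmx B -> psdmx (invmx M *m B *m invmx M).
Proof.
by move=> /pdmx_inv[Ms _] /(@psdmx_congr _ (invmx M)); rewrite Ms.
Qed.

Lemma bil_sandwich M B x : M^T = M ->
  bil (invmx M *m B *m invmx M) x x = bil B (invmx M *m x) (invmx M *m x).
Proof. by move=> Ms; rewrite -bil_congr trmx_inv Ms. Qed.

(** Cauchy-Schwarz for [M] makes [bil M x x *: invmx M - x *m x^T] positive semidefinite, so its
    trace against [B] is nonnegative. The trace stands in for the largest eigenvalue of [M^-1 B],
    which lets [B] have arbitrary rank. *)
Lemma psdmx_le_mxtrace M B x : pdmx M -> psdmx B ->
  bil B x x <= \tr (invmx M *m B) * bil M x x.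
Proof.
move=> Mp Bp; have Mu := pdmx_unit Mp; have [Ms Mx] := Mp.
have Pp : psdmx (bil M x x *: invmx M - x *m x^T).
  split=> [|y]; first by rewrite linearB linearZ /= trmx_mul trmxK trmx_inv Ms.
  rewrite bilD bilN bilZ.
  have -> : bil (x *m x^T) y y = bil M x (invmx M *m y) ^+ 2.
    rewrite bil_mulKV// /bil mulmxA -mulmxA mxE big_ord1 expr2.
    by congr (_ * _); rewrite -[y^T *m x]trmxK mxE trmx_mul trmxK.
  by rewrite bil_inv// subr_ge0 psdmx_CS//; exact: pdmx_psd.
have := mxtrace_psd_ge0 Pp Bp.
rewrite mulmxBl -scalemxAl linearB linearZ /= -bil_mxtrace subr_ge0.
by rewrite [X in _ <= X]mulrC.
Qed.

Lemma mxtrace_pd_gt0 M B : pdmx M -> psdmx B -> B != 0 -> 0 < \tr (M *m B).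
Proof.
move=> Mp Bp /(psdmx_neq0 Bp)[x xp].
have := psdmx_le_mxtrace x (pdmx_inv Mp) Bp; rewrite invmxK => h.
have Mx : 0 <= bil (invmx M) x x by apply: (proj2 (pdmx_psd (pdmx_inv Mp))).
rewrite lt_neqAle (mxtrace_psd_ge0 (pdmx_psd Mp) Bp) andbT.
by apply: contraTneq (lt_le_trans xp h) => <-; rewrite mul0r ltxx.
Qed.

(** * Perturbation bounds for resolvents *)

Section Perturbation.
Variables (M B : 'M[R]_n) (c s : R).
Hypotheses (Mp : pdmx M) (Bp : psdmx B) (s0 : 0 < s) (cs : c * s < 1).
Hypothesis (BM : forall x, bil B x x <= s * bil M x x).

(** The sign of [c] is free: the upper barrier subtracts a multiple of [B], the lower one adds it
    through a negative [c]. *)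
Lemma pdmx_perturb : pdmx (M - c *: B).
Proof.
have [Ms Mx] := Mp; have [Bs Bx] := Bp.
split=> [|x x0]; first by rewrite linearB linearZ /= Ms Bs.
rewrite bilD bilN bilZ subr_gt0; have [c0|c0] := leP c 0.
  by rewrite (le_lt_trans _ (Mx _ x0))// mulr_le0_ge0.
apply: (le_lt_trans (ler_wpM2l (ltW c0) (BM x))).
by rewrite mulrA gtr_pMl// Mx.
Qed.

(* With [z = M^-1 x] and [z + w = (M - c B)^-1 x], the difference of the two
   sides is bounded by [- s^-1 * bil B v v] for [v = c s z - (1 - c s) w]. *)
Lemma bil_resolvent_le x :
  (1 - c * s) * (bil (invmx (M - c *: B)) x x - bil (invmx M) x x)
    <= c * bil (invmx M *m B *m invmx M) x x.
Proof.
have [Ms Mx] := Mp; have [Bs Bx] := Bp.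
have Np := pdmx_perturb; have [Ns Nx] := Np.
have Mu := pdmx_unit Mp; have Nu := pdmx_unit Np.
rewrite bil_sandwich//.
set N := M - c *: B in Np Ns Nx Nu *.
set z := invmx M *m x; set y := invmx N *m x.
have [w yE] : exists w, y = z + w by exists (y - z); rewrite addrC subrK.
have e1 : bil (invmx N) x x = 2 * bil M z y - bil N y y.
  rewrite bil_inv// -/y.
  suff -> : bil M z y = bil N y y by ring.
  by rewrite (bilC z)// /z /y !bil_mulKV.
have e2 : bil (invmx M) x x = bil M z z by rewrite bil_inv.
rewrite e1 e2 /N bilD bilN bilZ yE !(bilDl, bilDr) (bilC w z Ms) (bilC w z Bs).
have := BM w; have := Bx ((c * s) *: z + (c * s - 1) *: w).
rewrite !(bilDl, bilDr, bilZl, bilZr) (bilC w z Bs).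
have cs0 : 0 < 1 - c * s by rewrite subr_gt0.
move: (bil M z z) (bil M z w) (bil M w w) (bil B z z) (bil B z w) (bil B w w).
move=> mzz mzw mww bzz bzw bww; set V := (V in 0 <= V -> _) => V0 bm.
rewrite -subr_ge0 -(pmulr_rge0 _ s0).
set G := (G in 0 <= G).
have -> : G = V + (1 - c * s) * (s * mww - bww) by rewrite /G /V; ring.
by rewrite addr_ge0// mulr_ge0 ?subr_ge0// ltW.
Qed.

End Perturbation.

(** This is the nonnegativity of the form of [M - c *: B] at the difference of the two solutions [y]
    and [z]. It expresses the convexity of matrix inversion, for [c] of either sign. *)
Lemma bil_resolvent_ge M B c x : pdmx M -> pdmx (M - c *: B) ->
  bil (invmx M) x x + c * bil (invmx M *m B *m invmx M) x x
    <= bil (invmx (M - c *: B)) x x.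
Proof.
move=> Mp Np; have [Ms Mx] := Mp; have [Ns Nx] := Np.
have Mu := pdmx_unit Mp; have Nu := pdmx_unit Np.
rewrite bil_sandwich// bil_inv//.
set N := M - c *: B in Np Ns Nx Nu *.
set z := invmx M *m x; set y := invmx N *m x.
have := proj2 (pdmx_psd Np) (y - z).
rewrite -scaleN1r !(bilDl, bilDr, bilZl, bilZr) (bilC y z Ns).
have -> : bil N z y = bil M z z by rewrite /y /z !bil_mulKV.
have -> : bil N z z = bil M z z - c * bil B z z by rewrite bilD bilN bilZ.
by rewrite (bil_inv _ _ Nu)// -/y; lra.
Qed.

Lemma mxtrace_psd_le L P Q : psdmx L -> P^T = P -> Q^T = Q ->
  (forall x, bil P x x <= bil Q x x) -> \tr (L *m P) <= \tr (L *m Q).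
Proof.
move=> Lp Ps Qs PQ; rewrite -subr_ge0 -linearB -mulmxBr mxtrace_psd_ge0//.
split=> [|x]; first by rewrite linearB /= Ps Qs.
by rewrite bilD bilN subr_ge0.
Qed.

Lemma pdmx_inv_sym M : pdmx M -> (invmx M)^T = invmx M.
Proof. by move=> [Ms _]; rewrite trmx_inv Ms. Qed.

Lemma psdmx_sandwich_sym M B : pdmx M -> psdmx B ->
  (invmx M *m B *m invmx M)^T = invmx M *m B *m invmx M.
Proof. by move=> Mp Bp; have [] := psdmx_sandwich Mp Bp. Qed.

Lemma mxtrace_resolvent_le L M B c s : psdmx L -> pdmx M -> psdmx B ->
    0 < s -> c * s < 1 -> (forall x, bil B x x <= s * bil M x x) ->
  (1 - c * s) * (\tr (L *m invmx (M - c *: B)) - \tr (L *m invmx M))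
    <= c * \tr (L *m (invmx M *m B *m invmx M)).
Proof.
move=> Lp Mp Bp s0 cs BM; have Np := pdmx_perturb Mp Bp cs BM.
rewrite -linearB -mulmxBr -!mxtraceZ 2!scalemxAr mxtrace_psd_le//.
- by rewrite linearZ linearB /= !pdmx_inv_sym.
- by rewrite linearZ /= psdmx_sandwich_sym.
by move=> x; rewrite !bilZ bilD bilN bil_resolvent_le.
Qed.

Lemma mxtrace_resolvent_ge L M B c : psdmx L -> pdmx M -> psdmx B ->
    pdmx (M - c *: B) ->
  \tr (L *m invmx M) + c * \tr (L *m (invmx M *m B *m invmx M))
    <= \tr (L *m invmx (M - c *: B)).
Proof.
move=> Lp Mp Bp Np.
rewrite -mxtraceZ scalemxAr -mxtraceD -mulmxDr mxtrace_psd_le//.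
- by rewrite linearD linearZ /= psdmx_sandwich_sym ?pdmx_inv_sym.
- by rewrite pdmx_inv_sym.
by move=> x; rewrite bilD bilZ bil_resolvent_ge.
Qed.

(** * Updates and shifts of the two barriers *)

Lemma upper_barrier_update L M B t D : psdmx L -> pdmx M -> psdmx B ->
    0 < t -> 0 < D ->
    t * (\tr (L *m (invmx M *m B *m invmx M)) / D + \tr (invmx M *m B)) < 1 ->
  pdmx (M - t *: B) /\
  \tr (L *m invmx (M - t *: B)) <= \tr (L *m invmx M) + D.
Proof.
move=> Lp Mp Bp t0 D0; set g := \tr (L *m _); set b := \tr (_ *m B) => h.
have b0 : 0 <= b by rewrite mxtrace_psd_ge0//; exact: pdmx_psd (pdmx_inv Mp).
have g0 : 0 <= g by rewrite mxtrace_psd_ge0//; exact: psdmx_sandwich.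
(* Any positive [s] strictly between [b] and [t^-1 - g / D] works: the first bound gives [B <= s M],
   the second makes the increase [t g / (1 - t s)] at most [D]. The midpoint is positive even if [b]
   is zero. *)
pose s := (b + (t^-1 - g / D)) / 2.
have bs : b < t^-1 - g / D.
  by rewrite ltrBrDl -(ltr_pM2l t0) divff ?gt_eqF.
have s0 : 0 < s by rewrite /s divr_gt0//; lra.
have sb : b <= s by rewrite /s; lra.
have st : t * s < 1 - t * (g / D).
  have -> : 1 - t * (g / D) = t * (t^-1 - g / D).
    by rewrite mulrBr divff ?gt_eqF.
  by rewrite ltr_pM2l// /s; lra.
have tgD : 0 <= t * (g / D) by rewrite mulr_ge0 ?divr_ge0 ?(ltW t0) ?(ltW D0).
have ts : t * s < 1 by lra.
have BM x : bil B x x <= s * bil M x x.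
  apply: (le_trans (psdmx_le_mxtrace x Mp Bp)).
  by rewrite ler_wpM2r// (proj2 (pdmx_psd Mp)).
split; first exact: (pdmx_perturb Mp Bp ts BM).
have := mxtrace_resolvent_le Lp Mp Bp s0 ts BM; rewrite -/g => h1.
rewrite -lerBlDl -(ler_pM2l (_ : 0 < 1 - t * s)) ?subr_gt0//.
apply: (le_trans h1); have -> : t * g = t * (g / D) * D.
  by rewrite mulrA divfK ?gt_eqF.
by rewrite ler_pM2r//; lra.
Qed.

Lemma lower_barrier_update L M B t D : psdmx L -> pdmx M -> psdmx B ->
    0 < t -> 0 < D ->
    1 < t * (\tr (L *m (invmx M *m B *m invmx M)) / D - \tr (invmx M *m B)) ->
  pdmx (M + t *: B) /\
  \tr (L *m invmx (M + t *: B)) <= \tr (L *m invmx M) - D.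
Proof.
move=> Lp Mp Bp t0 D0; set g := \tr (L *m _); set b := \tr (_ *m B) => h.
have b0 : 0 <= b by rewrite mxtrace_psd_ge0//; exact: pdmx_psd (pdmx_inv Mp).
(* As for the upper barrier, with [c = - t]: now [s <= g / D - t^-1] makes the decrease
   [t g / (1 + t s)] at least [D]. *)
pose s := (b + (g / D - t^-1)) / 2.
have bs : b < g / D - t^-1.
  by rewrite ltrBrDr -ltrBrDl -(ltr_pM2l t0) divff ?gt_eqF.
have s0 : 0 < s by rewrite /s divr_gt0//; lra.
have sb : b <= s by rewrite /s; lra.
have st : t * s < t * (g / D) - 1.
  have -> : t * (g / D) - 1 = t * (g / D - t^-1).
    by rewrite mulrBr divff ?gt_eqF.
  by rewrite ltr_pM2l// /s; lra.
have ts0 : 0 < t * s by rewrite mulr_gt0.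
have ts : - t * s < 1 by rewrite mulNr; lra.
have BM x : bil B x x <= s * bil M x x.
  apply: (le_trans (psdmx_le_mxtrace x Mp Bp)).
  by rewrite ler_wpM2r// (proj2 (pdmx_psd Mp)).
have E : M + t *: B = M - (- t) *: B by rewrite scaleNr opprK.
rewrite E; split; first exact: (pdmx_perturb Mp Bp ts BM).
have := mxtrace_resolvent_le Lp Mp Bp s0 ts BM; rewrite -/g => h1.
rewrite -lerBlDl -(ler_pM2l (_ : 0 < 1 - - t * s)) ?subr_gt0//.
apply: (le_trans h1); have -> : - t * g = - (t * (g / D) * D).
  by rewrite mulrA divfK ?gt_eqF// mulNr.
by rewrite mulrN lerN2 ler_pM2r// mulNr; lra.
Qed.

(** Convexity is applied at the shifted matrix [N], so the gain is evaluated there; it is the budget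
    that the next update may spend. *)
Lemma upper_barrier_shift L M d : psdmx L -> pdmx M -> 0 < d ->
  let N := M + d *: L in
  pdmx N /\
  \tr (L *m invmx N) + d * \tr (L *m (invmx N *m L *m invmx N))
    <= \tr (L *m invmx M).
Proof.
move=> Lp Mp d0 N.
have Np : pdmx N.
  split=> [|x x0]; first by rewrite linearD linearZ /= (proj1 Mp) (proj1 Lp).
  rewrite bilD bilZ ltr_wpDr ?(proj2 Mp)//.
  by rewrite mulr_ge0 ?(ltW d0)// (proj2 Lp).
split=> //; have ME : M = N - d *: L by rewrite /N addrK.
by rewrite [in leRHS]ME mxtrace_resolvent_ge// -ME.
Qed.

(** The first bound is the cost of the shift, to be repaid by the next update. The second, from
    comparing [M^-1 L M^-1] with [s M^-1], controls the potential between shift and update. *)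
Lemma lower_barrier_shift L M d : psdmx L -> pdmx M -> 0 < d ->
    0 < \tr (L *m invmx M) -> d * \tr (L *m invmx M) < 1 ->
  let N := M - d *: L in
  [/\ pdmx N,
      \tr (L *m invmx N)
        <= \tr (L *m invmx M) + d * \tr (L *m (invmx N *m L *m invmx N)) &
      (1 - d * \tr (L *m invmx M)) * \tr (L *m invmx N) <= \tr (L *m invmx M)].
Proof.
move=> Lp Mp d0 s0 ds N; set s := \tr (L *m invmx M) in s0 ds *.
have LM x : bil L x x <= s * bil M x x.
  by rewrite /s mxtrace_mulC psdmx_le_mxtrace.
have Np : pdmx N by exact: (pdmx_perturb Mp Lp ds LM).
have ME : M = N - (- d) *: L by rewrite /N scaleNr opprK subrK.
split=> //.
  have := mxtrace_resolvent_ge Lp Np Lp (c := - d).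
  by rewrite -ME => /(_ Mp); rewrite -/s mulNr lerBlDr.
have := mxtrace_resolvent_le Lp Mp Lp s0 ds LM; rewrite -/N -/s => h1.
have : \tr (L *m (invmx M *m L *m invmx M)) <= s * s.
  rewrite {2}/s -mxtraceZ scalemxAr mxtrace_psd_le//.
  - by rewrite psdmx_sandwich_sym.
  - by rewrite linearZ /= pdmx_inv_sym.
  move=> x; rewrite bilZ bil_sandwich ?(proj1 Mp)// bil_inv ?(proj1 Mp)//.
  exact: pdmx_unit.
move=> /(ler_wpM2l (ltW d0)) h2; have := le_trans h1 h2.
by rewrite mulrBr; lra.
Qed.

(** * The barrier method *)

Section BarrierStep.
Variables (I : finType) (B : I -> 'M[R]_n) (L : 'M[R]_n).
Hypotheses (n_gt0 : (0 < n)%N) (Bp : forall i, psdmx (B i)) (Lp : pdmx L).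
Hypotheses (LE : L = \sum_i B i).

Lemma pdmx_neq0 M : pdmx M -> M != 0.
Proof.
move=> Mp; have [x x0] : exists x : 'cV[R]_n, x != 0.
  exists (delta_mx (Ordinal n_gt0) 0); apply/eqP => /matrixP/(_ (Ordinal n_gt0) 0).
  by rewrite !mxE !eqxx => /eqP; rewrite oner_eq0.
by apply: contraTneq (proj2 Mp _ x0) => ->; rewrite bil0 ltxx.
Qed.

(** This trace occurs as a divisor in [barrier_step]. It is positive because multiplying back by [N]
    on both sides recovers [L], which is nonzero in positive dimension. *)
Lemma mxtrace_gap_gt0 N : pdmx N -> 0 < \tr (L *m (invmx N *m L *m invmx N)).
Proof.
move=> Np; apply: mxtrace_pd_gt0 => //.
  by apply: psdmx_sandwich => //; exact: pdmx_psd.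
have Nu := pdmx_unit Np; apply: contraNneq (pdmx_neq0 Lp) => h.
have <- : N *m (invmx N *m L *m invmx N) *m N = L.
  by rewrite -!mulmxA mulKVmx// mulVmx// mulmx1.
by rewrite h mulmx0 mul0mx.
Qed.

(* Summed over [i], the two quotients below are [d^-1 + \tr (L *m invmx N)]
   with the upper shift, and [1 - \tr (L *m invmx N')] with the lower one. *)
Lemma barrier_step (e : R) Mu Ml : 0 < e -> 8 * e <= 1 -> pdmx Mu -> pdmx Ml ->
    \tr (L *m invmx Mu) <= e -> \tr (L *m invmx Ml) <= e ->
  exists i t, 0 < t /\
    let Mu' := Mu + (1 - 4 * e)^-1 *: L - t *: B i in
    let Ml' := Ml - L + t *: B i in
    [/\ pdmx Mu', pdmx Ml', \tr (L *m invmx Mu') <= e & \tr (L *m invmx Ml') <= e].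
Proof.
move=> e0 e8; have e4 : 0 < 1 - 4 * e by lra.
have d0 : 0 < (1 - 4 * e)^-1 by rewrite invr_gt0.
have e1 : e < 1 by lra.
move=> Mup Mlp Mue Mle; have Ls := pdmx_psd Lp.
have [Np hN] := upper_barrier_shift Ls Mup d0.
have l0 : 0 < \tr (L *m invmx Ml).
  by rewrite mxtrace_pd_gt0 ?pdmx_neq0//; [exact/pdmx_psd/pdmx_inv|exact: pdmx_inv].
have l1 : 1 * \tr (L *m invmx Ml) < 1.
  by rewrite mul1r (le_lt_trans Mle).
have := lower_barrier_shift Ls Mlp ltr01 l0 l1.
rewrite /= scale1r !mul1r => -[Np' hN' hN''].
set N := Mu + _ in Np hN *; set N' := Ml - L in Np' hN' hN'' *.
have G0 := mxtrace_gap_gt0 Np; have G0' := mxtrace_gap_gt0 Np'.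
set G := \tr (L *m (invmx N *m L *m invmx N)) in hN G0.
set G' := \tr (L *m (invmx N' *m L *m invmx N')) in hN' G0'.
pose d := (1 - 4 * e)^-1.
have dG0 : 0 < d * G by rewrite mulr_gt0.
(* The updates use [D = d * G] above, which the upper shift has gained, and [D = G'] below, which
   covers the cost of the lower shift. A step of size [t] is admissible as soon as
   [U i < t^-1 < V i]. *)
pose U i := \tr (L *m (invmx N *m B i *m invmx N)) / (d * G) + \tr (invmx N *m B i).
pose V i := \tr (L *m (invmx N' *m B i *m invmx N')) / G' - \tr (invmx N' *m B i).
have sumG M : \sum_i \tr (L *m (invmx M *m B i *m invmx M)) =
              \tr (L *m (invmx M *m L *m invmx M)).
  by rewrite [X in invmx M *m X]LE mulmx_sumr mulmx_suml mulmx_sumr linear_sum.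
have sumT M : \sum_i \tr (invmx M *m B i) = \tr (L *m invmx M).
  by rewrite [RHS]mxtrace_mulC LE mulmx_sumr linear_sum.
have sumU : \sum_i U i = 1 - 4 * e + \tr (L *m invmx N).
  rewrite big_split /= -mulr_suml sumG sumT -/G; congr (_ + _).
  by rewrite invfM mulrCA divff ?gt_eqF// mulr1 invrK.
have sumV : \sum_i V i = 1 - \tr (L *m invmx N').
  by rewrite big_split /= -mulr_suml sumG sumrN sumT -/G' divff ?gt_eqF.
have UV : \sum_i U i < \sum_i V i.
  rewrite sumU sumV.
  have : 0 <= \tr (L *m invmx N').
    by rewrite mxtrace_psd_ge0//; exact/pdmx_psd/pdmx_inv.
  move: Mue Mle hN hN''; rewrite -/d.
  move: (\tr (L *m invmx N')) (\tr (L *m invmx N)) => b a.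
  move: (\tr (L *m invmx Mu)) (\tr (L *m invmx Ml)) dG0 => p q dG0 pe qe ap bq b0.
  (* Since [q <= e <= 1/8] and [(1 - q) b <= q], one has [b <= 8 e / 7], while [a < e]. So the first
     sum is below [1 - 3 e] and the second is at least [1 - 8 e / 7]. *)
  have : 7 / 8 * b <= (1 - q) * b by rewrite ler_wpM2r//; lra.
  by lra.
have [i Ui] : exists i, U i < V i.
  apply/existsP; apply: contraTT UV => /existsPn h; rewrite -leNgt.
  by apply: ler_sum => i _; rewrite leNgt h.
have U0 : 0 <= U i.
  rewrite addr_ge0 ?divr_ge0 ?(ltW dG0) ?mxtrace_psd_ge0//.
    exact: psdmx_sandwich.
  exact/pdmx_psd/pdmx_inv.
pose r := (U i + V i) / 2.
have r0 : 0 < r by rewrite /r; lra.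
exists i, r^-1; split; first by rewrite invr_gt0.
have [||Mu'p Mu'e] := @upper_barrier_update L N (B i) r^-1 (d * G) Ls Np (Bp i) _ dG0.
- by rewrite invr_gt0.
- by rewrite -/(U i) mulrC ltr_pdivrMr// mul1r /r; lra.
have [||Ml'p Ml'e] := @lower_barrier_update L N' (B i) r^-1 G' Ls Np' (Bp i) _ G0'.
- by rewrite invr_gt0.
- by rewrite -/(V i) mulrC ltr_pdivlMr// mul1r /r; lra.
split=> //.
  by apply: (le_trans Mu'e); apply: (le_trans hN).
by apply: (le_trans Ml'e); rewrite lerBlDr; apply: (le_trans hN'); rewrite lerD2r.
Qed.

Lemma pdmxZ a M : 0 < a -> pdmx M -> pdmx (a *: M).
Proof.
move=> a0 [Ms Mx]; split=> [|x x0]; first by rewrite linearZ /= Ms.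
by rewrite bilZ mulr_gt0 ?Mx.
Qed.

Lemma barrier_iter (e : R) m : 0 < e -> 8 * e <= 1 ->
  exists w : I -> R,
    let A := \sum_i w i *: B i in
    let Mu := (n%:R / e + m%:R / (1 - 4 * e)) *: L - A in
    let Ml := A - (m%:R - n%:R / e) *: L in
    [/\ forall i, 0 <= w i, (#|[pred i | w i != 0%R]| <= m)%N,
        pdmx Mu /\ pdmx Ml, \tr (L *m invmx Mu) <= e & \tr (L *m invmx Ml) <= e].
Proof.
move=> e0 e8; elim: m => [|m [w [w0 wm [Mup Mlp] Mue Mle]]].
  (* At the start [A = 0] and both barrier matrices are [(n / e) L], whose potential is exactly [e];
     this fixes the offset [n / e]. *)
  exists (fun=> 0) => /=.
  rewrite (eq_bigr (fun=> 0)); last by move=> i _; rewrite scale0r.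
  rewrite big1// mul0r addr0 !sub0r subr0 scaleNr opprK.
  have ne0 : 0 < n%:R / e by rewrite divr_gt0 ?ltr0n.
  have Mp := pdmxZ ne0 Lp.
  have trM : \tr (L *m invmx ((n%:R / e) *: L)) <= e.
    rewrite invmxZ ?(pdmx_unit Mp)//.
    rewrite -scalemxAr mulmxV ?pdmx_unit// mxtraceZ mxtrace1 invfM invrK.
    by rewrite mulrAC mulVf ?mul1r// pnatr_eq0 -lt0n.
  by split=> //; apply/eq_leq/eq_card0 => i; rewrite inE eqxx.
have [i [t [t0 [Mu'p Ml'p Mu'e Ml'e]]]] := barrier_step e0 e8 Mup Mlp Mue Mle.
exists (fun j => w j + (if j == i then t else 0)) => /=.
have -> : \sum_j (w j + (if j == i then t else 0)) *: B j =
          \sum_j w j *: B j + t *: B i.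
  rewrite (eq_bigr (fun j => w j *: B j + (if j == i then t *: B j else 0))).
    by rewrite big_split /= -big_mkcond big_pred1_eq.
  by move=> j _; rewrite scalerDl; case: eqP; rewrite ?scale0r.
set A := \sum_j w j *: B j.
have -> : (n%:R / e + m.+1%:R / (1 - 4 * e)) *: L - (A + t *: B i) =
    (n%:R / e + m%:R / (1 - 4 * e)) *: L - A + (1 - 4 * e)^-1 *: L - t *: B i.
  rewrite -natr1 mulrDl mul1r addrA [in LHS]scalerDl opprD !addrA.
  by congr (_ - _); rewrite addrAC.
have -> : A + t *: B i - (m.+1%:R - n%:R / e) *: L =
    A - (m%:R - n%:R / e) *: L - L + t *: B i.
  rewrite -natr1 [m%:R + 1 - _]addrAC [in LHS]scalerDl scale1r opprD !addrA.
  by rewrite [RHS]addrAC; congr (_ - _); rewrite addrAC.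
split=> //.
  by move=> j; rewrite addr_ge0//; case: ifP => // _; rewrite ltW.
apply: (@leq_trans #|i |: [set j | w j != 0%R]|).
  apply/subset_leq_card/fintype.subsetP => j; rewrite !inE.
  by have [//|_] := eqVneq j i; rewrite addr0.
by rewrite cardsU1 cardsE -add1n leq_add// leq_b1.
Qed.

End BarrierStep.

End PositiveMatrices.

(** * Sparsifying a finite family of positive semidefinite forms *)

Section SparsifyDefinite.
Variables (R : archiRealFieldType) (n : nat) (I : finType) (B : I -> 'M[R]_n).
Hypotheses (n_gt0 : (0 < n)%N) (Bp : forall i, psdmx (B i)).

Lemma sparsify_pd eps : pdmx (\sum_i B i) -> 0 < eps -> eps < 1 ->
  exists w : I -> R,
    [/\ forall i, 0 <= w i,
        #|[pred i | w i != 0]|%:R <= 82 * eps ^- 2 * n%:R &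
        forall x, (1 - eps) * \sum_i bil (B i) x x <= \sum_i w i * bil (B i) x x
                  <= (1 + eps) * \sum_i bil (B i) x x].
Proof.
move=> Lp eps0 eps1.
(* The upper error is at most [m e] from the offset [n / e], plus [8 m e] from
   [(1 - 4 e)^-1 <= 1 + 8 e]. Hence the 9, which also turns [eps < 1] into [8 * e <= 1]. *)
have [e ee] : exists e, eps = 9 * e by exists (eps / 9); field.
have e0 : 0 < e by move: eps0; rewrite ee pmulr_rgt0.
have e8 : 8 * e <= 1 by move: eps1; rewrite ee; lra.
have n0 : 0 < n%:R :> R by rewrite ltr0n.
pose r := n%:R / e ^+ 2; pose m := (Num.truncn r).+1.
have r0 : 0 < r by rewrite divr_gt0 ?exprn_gt0.
have [mr rm] : m%:R <= r + 1 /\ r < m%:R.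
  have /andP[h1 h2] := truncn_itv (ltW r0); split=> //.
  by rewrite /m -natr1 lerD2r.
have m0 : 0 < m%:R :> R by exact: lt_trans rm.
have [w [w0 wm [Mup Mlp] _ _]] := barrier_iter n_gt0 Bp Lp erefl m e0 e8.
exists (fun i => w i / m%:R); split=> [i||x].
- by rewrite divr_ge0// ltW.
- rewrite (eq_card (_ : _ =i [pred i | w i != 0])); last first.
    by move=> i; rewrite !inE mulf_eq0 invr_eq0 (gt_eqF m0) orbF.
  have /le_trans -> // : #|[pred i | w i != 0]|%:R <= r + 1.
    by rewrite (le_trans _ mr)// ler_nat.
  (* Here [r = 81 n / eps^2], and the 1 lost in rounding up is at most [n / eps^2]. *)
  have -> : 82 * eps ^- 2 * n%:R = r + eps ^- 2 * n%:R.
    by rewrite /r ee; field; rewrite gt_eqF.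
  rewrite lerD2l -[leLHS]mulr1 ler_pM ?ler1n// invf_ge1 ?exprn_gt0//.
  by rewrite expr_le1// ltW.
- have ner : n%:R / e = r * e.
    by rewrite /r expr2 invfM mulrA divfK ?gt_eqF.
  have -> : \sum_i w i / m%:R * bil (B i) x x
          = m%:R^-1 * bil (\sum_i w i *: B i) x x.
    rewrite bil_sum mulr_sumr; apply: eq_bigr => i _.
    by rewrite bilZ mulrA (mulrC m%:R^-1).
  rewrite -bil_sum.
  have := proj2 (pdmx_psd Mup) x; have := proj2 (pdmx_psd Mlp) x.
  have := proj2 (pdmx_psd Lp) x.
  rewrite !(bilD, bilN, bilZ) ner !subr_ge0.
  move: (bil (\sum_i B i) x x) (bil (\sum_i w i *: B i) x x) => l a l0 la au.
  rewrite ler_pdivlMl// ler_pdivrMl//.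
  have e4 : (1 - 4 * e)^-1 <= 1 + 8 * e.
    rewrite -[leLHS]mul1r ler_pdivrMr; last by lra.
    have : 0 <= e * (1 - 8 * e) by rewrite mulr_ge0 ?subr_ge0 ?(ltW e0).
    by lra.
  have rme : r * e <= m%:R * e by rewrite ler_wpM2r ?ltW.
  apply/andP; split.
    apply: le_trans la; rewrite mulrA ler_wpM2r//.
    have : 0 <= m%:R * e by rewrite mulr_ge0 ?ltW.
    by move: rme; rewrite ee; lra.
  apply: (le_trans au); rewrite mulrA ler_wpM2r//.
  have := ler_wpM2l (ltW m0) e4.
  by move: rme; rewrite ee; lra.
Qed.

End SparsifyDefinite.

Section Sparsify.
Variables (R : archiRealFieldType) (n : nat) (I : finType) (B : I -> 'M[R]_n).
Hypotheses (n_gt0 : (0 < n)%N) (Bp : forall i, psdmx (B i)).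

(* With [B0 = K^T K], the rows of [K] spanning [ker L], the matrix
   [M = L + B0] is definite and commutes with [L]; every form [B i] takes the
   same value at [x] as at [y = M^-1 L x], and [B0 y = 0]. *)
Lemma sparsify eps : 0 < eps ->
  exists w : I -> R,
    [/\ forall i, 0 <= w i,
        #|[pred i | w i != 0]|%:R <= 82 * eps ^- 2 * n%:R &
        forall x, (1 - eps) * \sum_i bil (B i) x x <= \sum_i w i * bil (B i) x x
                  <= (1 + eps) * \sum_i bil (B i) x x].
Proof.
move=> eps0; have [eps1|eps1] := leP 1 eps.
  (* For [eps >= 1] the lower bound is nonpositive, so zero weights do. *)
  exists (fun=> 0); split=> // [|x].
    rewrite (eq_card0 (A := _)) => [|i]; last by rewrite inE eqxx.
    by rewrite !mulr_ge0// invr_ge0 exprn_ge0 ?ltW.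
  have S0 : 0 <= \sum_i bil (B i) x x by apply: sumr_ge0 => i _; case: (Bp i).
  rewrite [X in _ <= X <= _]big1 => [|i _]; last by rewrite mul0r.
  by rewrite mulr_ge0 ?mulr_le0_ge0 ?subr_le0 ?addr_ge0 ?(ltW eps0).
set L := \sum_i B i; have Lp : psdmx L by exact: psdmx_sum.
have Ls := proj1 Lp.
pose K := kermx L; pose B0 := K^T *m 1%:M *m K.
have B0p : psdmx B0 by apply/psdmx_congr/pdmx_psd/pdmx1.
have B0s := proj1 B0p.
pose B' (o : I + unit) := if o is inl i then B i else B0.
have B'p o : psdmx (B' o) by case: o.
have sumB' (V : nmodType) (F : I + unit -> V) :
    \sum_o F o = \sum_i F (inl i) + F (inr tt).
  by rewrite big_sumType /= (big_pred1 tt)// => -[].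
have MS : \sum_o B' o = L + B0 by rewrite sumB'.
have B0L : B0 *m L = 0 by rewrite /B0 -mulmxA mulmx_ker mulmx0.
have LB0 : L *m B0 = 0 by rewrite -[LHS]trmxK trmx_mul Ls B0s B0L trmx0.
set M := L + B0 in MS; have Mp : pdmx M.
  split=> [|x x0]; first by rewrite linearD /= Ls B0s.
  rewrite bilD lt_neqAle addr_ge0 ?(proj2 Lp) ?(proj2 B0p)// andbT eq_sym.
  apply: contraNneq x0 => /eqP.
  rewrite paddr_eq0 ?(proj2 Lp) ?(proj2 B0p)// => /andP[/eqP Lx /eqP B0x].
  have {}Lx := psdmx_ker Lp Lx.
  have Kx : K *m x = 0.
    move: B0x; rewrite /B0 bil_congr => /(psdmx_ker (pdmx_psd (pdmx1 _ _))).
    by rewrite mul1mx.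
  have /sub_kermxP/submxP[D xD] : x^T *m L = 0.
    by rewrite -[LHS]trmxK trmx_mul trmxK Ls Lx trmx0.
  have : bil 1%:M x x = 0 by rewrite /bil mulmx1 xD -mulmxA Kx mulmx0 mxE.
  by move=> /(psdmx_ker (pdmx_psd (pdmx1 _ _))); rewrite mul1mx => ->.
have [|w [w0 wm wP]] := sparsify_pd n_gt0 B'p _ eps0 eps1; first by rewrite MS.
exists (fun i => w (inl i)); split=> // [|x].
  apply: le_trans wm; rewrite ler_nat -(@fintype.card_image _ _ (inl : I -> I + unit)).
    apply/subset_leq_card/fintype.subsetP => _ /fintype.imageP[i + ->].
    by rewrite !inE.
  by move=> i j [].
have Mu := pdmx_unit Mp.
pose y := invmx M *m L *m x.
have ML : M *m L = L *m L by rewrite /M mulmxDl B0L addr0.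
have LM : invmx M *m L = L *m invmx M.
  rewrite -[LHS](mulmxK Mu) -(mulmxA _ L) [L *m M]mulmxDr LB0 addr0 -ML.
  by rewrite mulKmx.
have B0y : B0 *m y = 0 by rewrite /y LM !mulmxA B0L !mul0mx.
have Lz : L *m (x - y) = 0.
  by rewrite mulmxBr /y !mulmxA -LM -(mulmxA _ L L) -ML mulKmx// subrr.
have Bz i : B i *m (x - y) = 0.
  apply: psdmx_ker => //.
  apply: (@psumr_eq0P _ I xpredT (fun i => bil (B i) (x - y) (x - y))) => //.
    by move=> j _; case: (Bp j).
  by rewrite -bil_sum -/L /bil -mulmxA Lz mulmx0 mxE.
have Bxy i : bil (B i) x x = bil (B i) y y.
  have Bxy : B i *m x = B i *m y by apply/eqP; rewrite -subr_eq0 -mulmxBr Bz.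
  rewrite /bil -mulmxA Bxy mulmxA -[LHS]/(bil _ _ _) bilC ?(proj1 (Bp i))//.
  by rewrite /bil -mulmxA Bxy mulmxA.
have := wP y; rewrite !sumB' /=.
have -> : bil B0 y y = 0 by rewrite /bil -mulmxA B0y mulmx0 mxE.
rewrite mulr0 !addr0 (eq_bigr _ (fun i _ => Bxy i)).
by under [X in _ -> _ <= X <= _]eq_bigr do rewrite Bxy.
Qed.
End Sparsify.

(** * Sums of squares on inner product spaces over R or C *)

Section InnerSpaces.
Variables (K : numFieldType) (theta : involutive_rmorphism K).
Implicit Types U V : inner_space K theta.

Lemma dotp_ge0 U (u : U) : 0 <= dotp U u u.
Proof. by have [->|/dotp_gt0/ltW//] := eqVneq u 0; rewrite linear0l. Qed.

Lemma dotp_conj U (u v : U) : dotp U u v = theta (dotp U v u).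
Proof. by rewrite hermC mul1r. Qed.

Lemma dotp_inj U (v w : U) : (forall u, dotp U u v = dotp U u w) -> v = w.
Proof.
move=> vw; apply/eqP; rewrite -subr_eq0; apply: contraT => /dotp_gt0.
by rewrite [dotp _ _ _]linearBr /= vw subrr ltxx.
Qed.

Lemma adjointZ U V c (f : 'Hom(U, V)) : adjoint (c *: f) = theta c *: adjoint f.
Proof.
apply/esym/adjoint_unique => u v.
by rewrite !lfunE /= dotpZl dotpZr adjointP rmorphK.
Qed.

Lemma adjoint_self V (A : 'End(V)) :
  (forall u v, dotp V (A u) v = dotp V u (A v)) -> adjoint A = A.
Proof. by move=> As; apply/esym/adjoint_unique. Qed.

End InnerSpaces.

Section Scalars.
Variables (R : realType) (k : ground_field).
Local Notation K := (scalar_field R k).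
Local Notation theta := (scalar_conj R k).

Definition real_part : K -> R :=
  match k with RealNumbers => idfun | ComplexNumbers => @complex.Re R end.

Lemma real_partD : {morph real_part : x y / x + y}.
Proof. by rewrite /real_part; case: k => // -[a b] [c d]. Qed.

Lemma real_part0 : real_part 0 = 0.
Proof. by rewrite /real_part; case: k. Qed.

Lemma real_part_sum (I : finType) (F : I -> K) :
  real_part (\sum_i F i) = \sum_i real_part (F i).
Proof. exact: (big_morph _ real_partD real_part0). Qed.

Lemma real_partZ a z : real_part (of_real k a * z) = a * real_part z.
Proof.
rewrite /real_part /of_real; move: z; case: k => // -[b c] /=.
by rewrite mul0r subr0.
Qed.

Lemma real_part_conj z : real_part (theta z) = real_part z.
Proof. by rewrite /real_part /scalar_conj; move: z; case: k => // -[]. Qed.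

Lemma real_part_ge0 z : 0 <= z -> 0 <= real_part z.
Proof. by rewrite /real_part; move: z; case: k => // -[a b]; rewrite lecE => /andP[]. Qed.

Lemma real_partK z : 0 <= z -> of_real k (real_part z) = z.
Proof.
rewrite /real_part /of_real; move: z; case: k => // -[a b].
by rewrite lecE => /andP[/eqP /= -> _].
Qed.

Lemma of_real_ge0 (a : R) : 0 <= a -> 0 <= of_real k a.
Proof. by rewrite /of_real; case: k => // a0; rewrite lecE /= eqxx. Qed.

Lemma of_realB : {morph of_real k : x y / x - y : R >-> x - y : K}.
Proof. by rewrite /of_real; case: k => // x y /=; rewrite rmorphB. Qed.

Lemma of_realM : {morph of_real k : x y / x * y : R >-> x * y : K}.
Proof. by rewrite /of_real; case: k => // x y /=; rewrite rmorphM. Qed.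

Lemma of_real_sum (I : finType) (F : I -> R) :
  of_real k (\sum_i F i) = \sum_i of_real k (F i).
Proof. by rewrite /of_real; case: k => //=; rewrite rmorph_sum. Qed.

Lemma conj_of_real a : theta (of_real k a) = of_real k a.
Proof.
by rewrite /of_real /scalar_conj; case: k => //=; exact: conjc_real.
Qed.

(** Treats both fields at once: [iota] is the imaginary unit over C and 0 over R, where the second
    coordinate is redundant. *)
Lemma scalar_span : exists iota : K, forall z, exists ab : R * R,
  z = of_real k ab.1 + of_real k ab.2 * iota.
Proof.
rewrite /of_real; case: k => /=.
  by exists 0 => z; exists (z, 0); rewrite mul0r addr0.
exists 'i%C => -[a b]; exists (a, b) => /=.
by apply/eqP; rewrite eq_complex /= !mul0r !mulr0 !mulr1 subrr !addr0 add0r !eqxx.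
Qed.

Lemma real_span (V : vectType K) : exists f : 'I_(\dim {:V} + \dim {:V}) -> V,
  forall v, exists x : 'cV[R]_(\dim {:V} + \dim {:V}),
    v = \sum_j of_real k (x j 0) *: f j.
Proof.
have [iota iotaP] := scalar_span.
pose e := vbasis {:V}.
exists (fun j => match fintype.split j with inl i => e`_i | inr i => iota *: e`_i end).
move=> v; have [ab abP] := choice (fun i => iotaP (coord e i v)).
exists (col_mx (\col_i (ab i).1) (\col_i (ab i).2)).
rewrite big_split_ord /= {1}(coord_vbasis (memvf v)) -big_split /=.
apply: eq_bigr => i _; rewrite col_mxEu col_mxEd !mxE.
rewrite (unsplitK (inl i)) (unsplitK (inr i)).
by rewrite {1}abP scalerDl scalerA.
Qed.

Lemma sparsify_maps (V : vectType K) (I : finType) (W : I -> inner_space K theta)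
    (z : forall i, V -> W i) (eps : R) :
  (forall i, linear (z i)) -> (0 < \dim {:V})%N -> 0 < eps ->
  exists w : I -> R,
    [/\ forall i, 0 <= w i,
        #|[pred i | w i != 0]|%:R <= 164 * eps ^- 2 * (\dim {:V})%:R &
        let q v i := real_part (dotp (W i) (z i v) (z i v)) in
        forall v, (1 - eps) * \sum_i q v i <= \sum_i w i * q v i
                    <= (1 + eps) * \sum_i q v i].
Proof.
move=> zlin V0 eps0; have [f fP] := real_span V.
(* Gram matrices in real coordinates: taking real parts makes the Hermitian forms symmetric. There
   are twice [\dim] coordinates, which doubles the constant 82. *)
pose B i := \matrix_(j, l) real_part (dotp (W i) (z i (f j)) (z i (f l))).
have bilB i (x : 'cV[R]_(\dim {:V} + \dim {:V})) v : v = \sum_j of_real k (x j 0) *: f j ->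
    bil (B i) x x = real_part (dotp (W i) (z i v) (z i v)).
  move=> ->; pose zL := GRing.isLinear.Build _ _ _ _ (z i) (zlin i).
  pose zl : {linear V -> W i} := HB.pack (z i) zL.
  have -> : z i (\sum_j of_real k (x j 0) *: f j) =
            \sum_j of_real k (x j 0) *: z i (f j).
    transitivity (\sum_j z i (of_real k (x j 0) *: f j)).
      exact: (linear_sum zl).
    by apply: eq_bigr => j _; exact: (linearZ_LR zl).
  rewrite linear_sumlz real_part_sum /bil mxE.
  under eq_bigr do rewrite mxE mulr_suml.
  rewrite exchange_big /=; apply: eq_bigr => j _.
  rewrite linear_sumr real_part_sum; apply: eq_bigr => l _ /=.
  rewrite dotpZr dotpZl conj_of_real !real_partZ !mxE.
  by rewrite mulrC mulrA.
have Bp i : psdmx (B i).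
  split=> [|x].
    by apply/matrixP => j l; rewrite !mxE [in LHS]dotp_conj real_part_conj.
  by rewrite (bilB _ _ _ erefl) real_part_ge0 ?dotp_ge0.
have [|w [w0 wm wP]] := sparsify _ Bp eps0; first by rewrite addn_gt0 V0.
exists w; split=> //.
  by apply: (le_trans wm); rewrite natrD; lra.
move=> q v; have [x xP] := fP v.
have E i : bil (B i) x x = q v i := bilB i x v xP.
have := wP x; rewrite (eq_bigr _ (fun i _ => E i)).
by rewrite [X in _ <= X <= _](eq_bigr (fun i => w i * q v i))// => i _; rewrite E.
Qed.

End Scalars.

(** * Rescaling a cosheaf *)

Section Coboundary.
Variables (K : numFieldType) (theta : involutive_rmorphism K).
Variables (P : face_poset) (F : cosheaf K theta P) (inc : incidence P) (k : nat).

(** The component at [t] of the adjoint of the boundary map, by [adjoint_boundaryE]. *)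
Definition coboundary (t : kcell P k.+1) (v : chain F k) : stalk F (val t) :=
  \sum_(s : kcell P k)
    (inc (val s) (val t))%:~R *: adjoint (ext F (val s) (val t)) (v s).

Lemma coboundary_linear t : linear (coboundary t).
Proof.
move=> a x y; rewrite /coboundary scaler_sumr -big_split /=.
apply: eq_bigr => s _.
by rewrite !ffunE linearP scalerDr !scalerA mulrC.
Qed.

Lemma adjoint_boundaryE v t : adjoint (boundary F inc k) v t = coboundary t v.
Proof.
move: t; suff -> : adjoint (boundary F inc k) v = [ffun t => coboundary t v].
  by move=> t; rewrite ffunE.
apply: dotp_inj => c; rewrite -adjointP lfunE /= /dsum_form.
under eq_bigr do rewrite ffunE linear_sumlz.
rewrite exchange_big /=; apply: eq_bigr => t _.
rewrite ffunE linear_sumr; apply: eq_bigr => s _ /=.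
by rewrite dotpZl dotpZr rmorph_int adjointP.
Qed.

Lemma dotp_up_laplacian u v :
  dotp (chain F k) (up_laplacian F inc k u) v =
  \sum_t dotp (stalk F (val t)) (coboundary t u) (coboundary t v).
Proof.
rewrite /up_laplacian comp_lfunE adjointP /= /dsum_form.
by apply: eq_bigr => t _; rewrite !adjoint_boundaryE.
Qed.

End Coboundary.

Section Rescaling.
Variables (K : numFieldType) (theta : involutive_rmorphism K).
Variables (P : face_poset) (F : cosheaf K theta P) (S : {set cell P}).
Variable a : cell P -> K.
Hypothesis a_face : forall s t, face s t -> s != t -> t \in S -> a s = 1.

(** The diagonal value 1 keeps the extension map from a cell to itself the identity. *)
Let coef (s t : cell P) := if s == t then 1 else a t.

Definition rescaled_ext (s t : cell (subcomplex S)) :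
  'Hom(stalk F (val t), stalk F (val s)) :=
  coef (val s) (val t) *: ext F (val s) (val t).

Lemma rescaled_ext_id s : rescaled_ext s s = \1%VF.
Proof. by rewrite /rescaled_ext /coef eqxx scale1r ext_id. Qed.

(** For distinct [r], [s], [t] the factor [a s] is 1 by [a_face], so only the factor of the largest
    cell survives on both sides; antisymmetry excludes [r = t]. *)
Lemma rescaled_ext_comp (r s t : cell (subcomplex S)) : face r s -> face s t ->
  rescaled_ext r t = (rescaled_ext r s \o rescaled_ext s t)%VF.
Proof.
move=> rs st; rewrite /rescaled_ext (ext_comp F rs st).
rewrite -comp_lfunZl -comp_lfunZr scalerA; congr (_ *: _).
rewrite /coef; have [->|neq_st] := eqVneq (val s) (val t).
  by rewrite mulr1.
have [rs_eq|neq_rs] := eqVneq (val r) (val s).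
  by rewrite rs_eq (negPf neq_st) mul1r.
rewrite (a_face st neq_st (valP t)) mul1r.
have [rt|//] := eqVneq (val r) (val t).
case/eqP: neq_st; apply: (@face_anti P); rewrite [face _ _]st /=.
by rewrite -rt; exact: rs.
Qed.

Definition rescaled : cosheaf K theta (subcomplex S) :=
  @Cosheaf _ _ (subcomplex S) (fun s => stalk F (val s)) rescaled_ext
    rescaled_ext_id rescaled_ext_comp.

Definition rescaled_stalks k : same_stalks k F rescaled := fun s _ => erefl.

Variables (inc : incidence P) (k : nat).
Hypothesis kS : cells P k \subset S.

Lemma chain_transport_rescaledE (v : chain F k) (s : kcell (subcomplex S) k) :
  chain_transport (@rescaled_stalks k) v s = v (kcell_incl s).
Proof. by rewrite lfunE ffunE. Qed.

Lemma coboundary_rescaled (t : kcell (subcomplex S) k.+1) (v : chain F k) :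
  coboundary (sub_incidence inc) t (chain_transport (@rescaled_stalks k) v)
  = theta (a (val (val t))) *: coboundary inc (kcell_incl t) v.
Proof.
rewrite /coboundary scaler_sumr.
rewrite [RHS](reindex (@kcell_incl P S k)); last exact/onW_bij/kcell_incl_bij.
apply: eq_bigr => s _.
have neq_st : val (val s) == val (val t) = false.
  apply: contraTF (valP t) => /eqP st; rewrite /= /sub_cell_dim -st.
  by have /eqP/= := valP s; rewrite /sub_cell_dim => ->; rewrite eqn_leq ltnn andbF.
have -> : adjoint (ext rescaled (val s) (val t)) =
          theta (a (val (val t))) *: adjoint (ext F (val (val s)) (val (val t))).
  by rewrite /= /rescaled_ext /coef neq_st adjointZ.
by rewrite lfunE scalerA mulrC -scalerA chain_transport_rescaledE.
Qed.

Lemma dotp_transport_end (A : 'End(chain rescaled k)) u v :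
  dotp (chain F k) (transport_end (@rescaled_stalks k) A u) v =
  dotp (chain rescaled k) (A (chain_transport (@rescaled_stalks k) u))
    (chain_transport (@rescaled_stalks k) v).
Proof.
rewrite -(chain_transport_isometry (@rescaled_stalks k) kS).
congr (dotp _ _ _); rewrite /transport_end !comp_lfunE limg_lfunVK//.
(* The transport is onto, so its pseudo-inverse is a right inverse everywhere. *)
have [g gK Kg] := chain_transport_bij (@rescaled_stalks k) kS.
by rewrite -[X in X \in _]Kg memv_img ?memvf.
Qed.

Lemma dotp_up_laplacian_rescaled u v :
  dotp (chain F k)
    (transport_end (@rescaled_stalks k) (up_laplacian rescaled (sub_incidence inc) k) u) v =
  \sum_(t : kcell (subcomplex S) k.+1)
    theta (a (val (val t))) * (a (val (val t)) *
      dotp (stalk F (val (kcell_incl t)))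
        (coboundary inc (kcell_incl t) u) (coboundary inc (kcell_incl t) v)).
Proof.
rewrite dotp_transport_end dotp_up_laplacian; apply: eq_bigr => t _.
by rewrite !coboundary_rescaled dotpZl dotpZr rmorphK.
Qed.

End Rescaling.

(** * The weighted subcomplex and its Laplacian *)

Section Sparsification.
Variables (R : realType) (k : ground_field).
Local Notation K := (scalar_field R k).
Local Notation theta := (scalar_conj R k).

(** Real coefficients make [D] self-adjoint, and each [dotp (W i) (z i v) (z i v)] is real, so
    positivity over the field becomes an inequality in [R]. *)
Lemma psd_real_combination (V : inner_space K theta) (I : finType)
    (W : I -> inner_space K theta) (z : forall i, V -> W i) (D : 'End(V)) (b : I -> R) :
  (forall u v, dotp V (D u) v =
    \sum_i of_real k (b i) * dotp (W i) (z i u) (z i v)) ->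
  (forall v, 0 <= \sum_i b i * real_part (dotp (W i) (z i v) (z i v))) ->
  psd D.
Proof.
move=> DE b0; split=> [|v].
  apply: adjoint_self => u v; rewrite [RHS]dotp_conj !DE rmorph_sum.
  apply: eq_bigr => i _; rewrite rmorphM; congr (_ * _).
    exact/esym/conj_of_real.
  exact: dotp_conj.
rewrite DE (eq_bigr (fun i => of_real k (b i * real_part (dotp (W i) (z i v) (z i v))))).
  by rewrite -of_real_sum of_real_ge0.
by move=> i _; rewrite of_realM real_partK ?dotp_ge0.
Qed.

Variables (P : face_poset) (d : nat) (w : kcell P d -> R).

(** The default 1 keeps all cells of dimension other than [d] in the support and leaves them
    unscaled. *)
Definition cell_weight (s : cell P) : R :=
  if insub s is Some t then w t else 1.

Definition weight_support : {set cell P} := [set s | cell_weight s != 0].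

Lemma cell_weight_val t : cell_weight (val t) = w t.
Proof. by rewrite /cell_weight valK. Qed.

Lemma cell_weight_dim s : cell_dim s != d -> cell_weight s = 1.
Proof. by move=> sd; rewrite /cell_weight insubN. Qed.

Lemma sum_weight_support (V : nmodType) (G : kcell P d -> V) :
  (forall t, w t = 0 -> G t = 0) ->
  \sum_(t : kcell (subcomplex weight_support) d) G (kcell_incl t) = \sum_t G t.
Proof.
move=> G0; rewrite [RHS](bigID (fun t => w t == 0)) /= [X in _ = X + _]big1 ?add0r; last first.
  by move=> t /eqP wt; rewrite G0.
have inj : injective (@kcell_incl P weight_support d).
  by move=> s t /(congr1 val) /= /val_inj/val_inj.
transitivity (\sum_(t in [set kcell_incl t | t in
    [set: kcell (subcomplex weight_support) d]]) G t).
  rewrite big_imset /=; last by move=> ? ? _ _ /inj.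
  by apply: eq_bigl => t; rewrite inE.
apply: eq_bigl => t; apply/imsetP/idP => [[s _ ->]|wt].
  by have := valP (val s); rewrite inE -cell_weight_val.
have tS : val t \in weight_support by rewrite inE cell_weight_val.
exists (exist _ (exist _ (val t) tS : cell (subcomplex weight_support)) (valP t)) => //.
exact: val_inj.
Qed.

Lemma card_cells_weight_support :
  (#|cells (subcomplex weight_support) d| <= #|[pred t | w t != 0%R]|)%N.
Proof.
rewrite -(card_imset _ (@val_inj _ _ (sub_cell weight_support))).
rewrite -(@fintype.card_image _ _ (val : kcell P d -> cell P)); last exact: val_inj.
apply/subset_leq_card/fintype.subsetP => _ /imsetP[s sd ->].
have sd' : cell_dim (val s) == d by move: sd; rewrite inE.
apply/fintype.imageP; exists (exist _ (val s) sd') => //.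
by have := valP s; rewrite !inE -cell_weight_val.
Qed.

End Sparsification.

Theorem theorem6p4 (R : realType) :
  exists C : R,
  forall (k : ground_field) (X : regular_cell_complex R)
    (inc : incidence X) (F : cosheaf (scalar_field R k) (scalar_conj R k) X)
    (d n : nat) (eps : R),
    signed_incidence inc ->
    (1 <= d)%N -> dimension X = d ->
    \dim {: chain F d.-1} = n -> (2 <= n)%N ->
    0 < eps ->
  exists (S : {set cell X})
    (F' : cosheaf (scalar_field R k) (scalar_conj R k) (subcomplex S))
    (E : same_stalks d.-1 F F'),
    [/\ is_subcomplex S,
        [set val s | s in skeleton (subcomplex S) d.-1] = skeleton X d.-1,
        #|cells (subcomplex S) d|%:R <= C * eps ^- 2 * n%:R * ln n%:R,
        loewner_le (of_real k (1 - eps) *: up_laplacian F inc d.-1)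
          (transport_end E (up_laplacian F' (sub_incidence inc) d.-1)) &
        loewner_le (transport_end E (up_laplacian F' (sub_incidence inc) d.-1))
          (of_real k (1 + eps) *: up_laplacian F inc d.-1)].
Proof.
have ln2 : 0 < ln (2 : R) by rewrite ln_gt0// ltr1n.
(* The weights give a bound linear in [n]; as [n >= 2], the factor [ln n / ln 2] is at least 1 and
   supplies the logarithm. From here on the top dimension is [d.+1]. *)
exists (164 / ln 2) => k X inc F [//|d] n eps _ _ Xd; rewrite [d.+1.-1]/= => dimF n2 eps0.
have dim_le (s : cell X) : (cell_dim s <= d.+1)%N by rewrite -Xd leq_bigmax.
have V0 : (0 < \dim {: chain F d})%N by rewrite dimF (leq_trans _ n2).
have [w [w0 wm wP]] :=
  sparsify_maps (fun t => @coboundary_linear _ _ _ F inc d t) V0 eps0.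
(* Square roots, because a real factor on the extension maps out of a cell enters the Laplacian
   squared. *)
pose S := weight_support w; pose a s := of_real k (Num.sqrt (cell_weight w s)).
(* A proper face lies below the top dimension and has the default weight 1; this yields both the
   cosheaf law and the closure of [S] under faces. *)
have face_weight s t : face s t -> s != t -> cell_weight w s = 1.
  move=> st neq_st; apply: cell_weight_dim; apply: contraTneq (dim_le t) => sd.
  by rewrite -ltnNge -sd face_dim.
have a_face s t : face s t -> s != t -> t \in S -> a s = 1.
  move=> st neq_st _; rewrite /a (face_weight _ _ st neq_st) sqrtr1.
  by rewrite /of_real; case: (k).
have low_weight s : (cell_dim s <= d)%N -> s \in S.
  by move=> sd; rewrite inE cell_weight_dim ?oner_eq0// neq_ltn ltnS sd.
have kS : cells X d \subset S.
  by apply/fintype.subsetP => s; rewrite inE => /eqP sd; rewrite low_weight ?sd.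
pose E := @rescaled_stalks _ _ _ F S a a_face d.
exists S, (rescaled F a_face), E.
have of_real0 : of_real k (0 : R) = 0 by rewrite -[0 in LHS](subrr 0) of_realB subrr.
have rescaledE u v : dotp (chain F d) (transport_end E
      (up_laplacian (rescaled F a_face) (sub_incidence inc) d) u) v =
    \sum_t of_real k (w t) *
      dotp (stalk F (val t)) (coboundary inc t u) (coboundary inc t v).
  rewrite dotp_up_laplacian_rescaled//.
  rewrite -(@sum_weight_support _ _ _ w _ (fun t => of_real k (w t) *
      dotp (stalk F (val t)) (coboundary inc t u) (coboundary inc t v))); last first.
    by move=> t ->; rewrite of_real0 mul0r.
  apply: eq_bigr => t _; rewrite mulrA; congr (_ * _).
  rewrite /a conj_of_real -of_realM -expr2 sqr_sqrtr ?(cell_weight_val w (kcell_incl t))//.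
have scaledE c u v :
  dotp (chain F d) ((of_real k c *: up_laplacian F inc d) u) v =
  \sum_t of_real k c *
      dotp (stalk F (val t)) (coboundary inc t u) (coboundary inc t v).
  by rewrite lfunE dotpZl dotp_up_laplacian mulr_sumr.
have sumB (b b' : kcell X d.+1 -> R) u v :
    \sum_t of_real k (b t) *
      dotp (stalk F (val t)) (coboundary inc t u) (coboundary inc t v) -
    \sum_t of_real k (b' t) *
      dotp (stalk F (val t)) (coboundary inc t u) (coboundary inc t v) =
    \sum_t of_real k (b t - b' t) *
      dotp (stalk F (val t)) (coboundary inc t u) (coboundary inc t v).
  by rewrite -sumrB; apply: eq_bigr => t _; rewrite -mulrBl of_realB.
split.
- move=> s t st tS; have [->//|neq_st] := eqVneq s t.
  by rewrite inE (face_weight _ _ st neq_st) oner_eq0.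
- apply/setP => s; rewrite inE; apply/imsetP/idP => [[t + ->]|sd].
    by rewrite inE.
  by exists (exist _ s (low_weight s sd) : cell (subcomplex S)); rewrite ?inE.
- have n0 : 0 <= n%:R :> R by [].
  have lnn : ln 2 <= ln n%:R :> R by rewrite ler_ln ?posrE ?ltr0n ?ler_nat// (ltnW n2).
  have /le_trans -> // : #|cells (subcomplex S) d.+1|%:R <= 164 * eps ^- 2 * n%:R.
    by rewrite -dimF; apply: le_trans wm; rewrite ler_nat card_cells_weight_support.
  have -> : 164 / ln 2 * eps ^- 2 * n%:R * ln n%:R =
            164 * eps ^- 2 * n%:R * (ln n%:R / ln 2) by rewrite !mulrA; ring.
  by rewrite ler_peMr ?ler_pdivlMr ?mul1r// !mulr_ge0// invr_ge0 exprn_ge0// ltW.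
(* The difference of the two operators is a combination of the same squares, with coefficients
   [w t - (1 - eps)]. *)
- apply: (@psd_real_combination R k (chain F d) (kcell X d.+1)
    (fun t => stalk F (val t)) (@coboundary _ _ _ F inc d) _
    (fun t => w t - (1 - eps))).
    move=> u v; rewrite add_lfunE opp_lfunE [LHS]linearBl.
    rewrite -(sumB w (fun=> 1 - eps)); congr (_ - _); [exact: rescaledE|exact: scaledE].
  move=> v; under eq_bigr do rewrite mulrBl.
  by rewrite sumrB -mulr_sumr subr_ge0; have /andP[] := wP v.
apply: (@psd_real_combination R k (chain F d) (kcell X d.+1)
    (fun t => stalk F (val t)) (@coboundary _ _ _ F inc d) _
  (fun t => 1 + eps - w t)).
  move=> u v; rewrite add_lfunE opp_lfunE [LHS]linearBl.
  rewrite -(sumB (fun=> 1 + eps) w); congr (_ - _); [exact: scaledE|exact: rescaledE].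
move=> v; under eq_bigr do rewrite mulrBl.
by rewrite sumrB -mulr_sumr subr_ge0; have /andP[] := wP v.
Qed.
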